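(* Let $G$ be a group, $\mathbb{S}$ an idempotent semifield, $n\in\mathbb{N}$, $V=\mathbb{S}^n$, and $G\to \mathrm{GL}(V)$ a group homomorphism (a linear representation of $G$ over $\mathbb{S}$). A tropical representation in $V$ means a $G$-invariant tropical linear space $T\subseteq V$. (1) For any $1\le d\le n$, the induced linear action of $G$ on $\bigwedge^d V$ restricts to an action on the Dressian $Dr(d,n)\subseteq \mathbb{P}(\bigwedge^d V)$, and the $d$-dimensional tropical representations in $V$ are equivalent to the $G$-fixed points in $Dr(d,n)$: the assignment $[v]\mapsto T_v$ is a bijection from the set of $G$-fixed points of $Dr(d,n)$ to the set of $d$-dimensional tropical representations in $V$. (2) If $\mathbb{S}=\mathbb{B}=\{0,1\}$, then a tropical representation $T\subseteq V$ is equivalent to a homomorphism from $G$ to the automorphism group of the matroid $M(T)$ corresponding to $T$: for a tropical linear space $T\subseteq \mathbb{B}^n$, a homomorphism $G\to\mathrm{GL}(\mathbb{B}^n)\cong\Sigma_n$ leaves $T$ invariant if and only if it takes values in $\mathrm{Aut}(M(T))\subseteq\Sigma_n$. (3) The stable sum and the stable intersection (whenever defined) of two tropical representations in $V$ are tropical representations in $V$. If $\mathbb{S}$ is totally ordered, then for every tropical representation $T\subseteq V$ the orthogonal dual $T^\perp\subseteq V^\vee$ is a tropical representation, for the dual action of $G$ on $V^\vee$. (4) Let $\nu:k\to\mathbb{S}$ be a field with valuation and let $G\to\mathrm{GL}(W)$, $W=k^n$, be a monomial representation. Then applying $\nu$ entry-wise to the matrices of the elements of $G$ yields a linear representation $G\to\mathrm{GL}(\mathbb{S}^n)$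 over $\mathbb{S}$; for every $G$-invariant linear subspace $L\subseteq W$ the tropicalization $\mathrm{trop}(L)\subseteq\mathbb{S}^n$ is a tropical representation for this linear representation; and tropicalization is $G$-equivariant, i.e. $\mathrm{trop}(g\cdot L)=g\cdot\mathrm{trop}(L)$ for every linear subspace $L\subseteq W$ and every $g\in G$.
   Context: An idempotent semifield $\mathbb{S}$ is a commutative semiring satisfying all field axioms except existence of additive inverses, with $s+s=s$ for all $s$. It is partially ordered by $a\le b\Leftrightarrow a+b=b$; ''totally ordered'' refers to this order. $\mathbb{B}=\{0,1\}$ is the Boolean semifield ($1+1=1$). Let $V\cong\mathbb{S}^n$ be free with basis $e_1,\dots,e_n$, $V^\vee=\mathrm{Hom}(V,\mathbb{S})$ with dual basis $x_1,\dots,x_n$. Every linear automorphism of $V$ is given by a monomial matrix (exactly one nonzero entry in each row and column): $\mathrm{GL}(V)\cong\Sigma_n\ltimes(\mathbb{S}^\times)^n$. In particular $\mathrm{GL}(\mathbb{B}^n)\cong\Sigma_n$. $G$ acts on $V^\vee$ by $g\cdot\varphi=\varphi\circ g^{-1}$. Exterior algebra: $\bigwedge V$ is the quotient of the symmetric algebra of $V$ by the congruence generated by $e_i^2\sim 0$ for all $i$; $\bigwedge^dV$ is free with basis $e_I$, $I\in\binom{[n]}{d}$, where $e_I=e_{i_1}\wedge\cdots\wedge e_{i_d}$. Multiplication is commutative, with $e_I\wedge e_J=e_{I\cup J}$ if $I\cap J=\emptyset$ and $0$ otherwise. If $g\cdot e_i=\lambda_ie_{\sigma(i)}$ then $g\cdot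 e_I=(\prod_{i\in I}\lambda_i)e_{\sigma(I)}$. Similarly for $V^\vee$ with basis $x_I$ of $\bigwedge^dV^\vee$. A rank $d$ tropical Plücker vector is a nonzero $v=\sum v_Ie_I\in\bigwedge^dV$ satisfying the tropical Plücker relations: $\sum_{i\in A\setminus B}v_{A\setminus i}v_{B\cup i}=\sum_{i\in(A\setminus B)\setminus j}v_{A\setminus i}v_{B\cup i}$ for all $A\in\binom{[n]}{d+1}$, $B\in\binom{[n]}{d-1}$, $j\in A\setminus B$. The Dressian $Dr(d,n)\subseteq\mathbb{P}(\bigwedge^dV)$ is the set of classes, modulo scaling by $\mathbb{S}^\times$, of rank $d$ tropical Plücker vectors. The tropical hyperplane in $V$ defined by $\sum a_ix_i\in V^\vee$ is the set of $p=\sum p_ie_i$ with $\sum_ia_ip_i=\sum_{i\ne j}a_ip_i$ for every $j$. The tropical linear space $T_v\subseteq V$ of rank (dimension) $d$ is the intersection over all $A\in\binom{[n]}{d+1}$ of the tropical hyperplanes defined by $\sum_{i\in A}v_{A\setminus i}x_i$. It depends only on, and determines, the class $[v]$. A tropical linear space is a submodule of the form $T_v$. The same definitions apply to $V^\vee$. If $\mathbb{S}=\mathbb{B}$, $M(T_v)$ is the matroid on $[n]$ with bases $\{I: v_I=1\}$; a matroid automorphism is a permutation of $[n]$ sending independent sets to independent sets. Hodge star: $\star:\bigwedge^{d}V\to\bigwedge^{n-d}V^\vee$ is the linear isomorphism $e_I\mapsto x_{[n]\setminus I}$, and likewise $x_I\mapsto e_{[n]\setminus I}$. For tropical Plücker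 vectors $v\in\bigwedge^dV$, $v'\in\bigwedge^{d'}V$: if $v\wedge v'\neq0$ it is a tropical Plücker vector and the stable sum of $T_v$ and $T_{v'}$ is $T_{v\wedge v'}$; if $\star v\wedge\star v'\ne0$, the stable intersection is $T_{\star(\star v\wedge\star v')}$. The orthogonal dual $M^\perp\subseteq V^\vee$ of a submodule $M\subseteq V$ is the intersection of the tropical hyperplanes in $V^\vee$ defined by the elements of $M$ (viewed as linear forms on $V^\vee$ via $V\cong V^{\vee\vee}$). A valuation $\nu:k\to\mathbb{S}$ on a field $k$ is a multiplicative map with $\nu(0)=0$, $\nu(1)=\nu(-1)=1$ and $\nu(a+b)+\nu(a)+\nu(b)=\nu(a)+\nu(b)$. With the standard basis of $W=k^n$ fixed, a monomial representation is one in which every $g\in G$ acts by a monomial matrix. For a linear subspace $L\subseteq W$, $\mathrm{trop}(L)\subseteq\mathbb{S}^n$ is the $\mathbb{S}$-submodule generated by the coordinate-wise valuations $\nu(w)$, $w\in L$. *)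

(* Defs.v *)
From HB Require Import structures.
From mathcomp Require Import all_boot all_fingroup all_algebra.
From mathcomp Require Import boolp classical_sets functions.

Set Implicit Arguments.
Unset Strict Implicit.
Unset Printing Implicit Defensive.

Import GRing.Theory.
Local Open Scope ring_scope.

(** * Idempotent semifields *)

(* 0 <> 1 is part of [comNzSemiRingType]. *)
Definition idempotent_semifield (S : comNzSemiRingType) : Prop :=
  (forall a : S, a + a = a) /\
  (forall a : S, a != 0 -> exists b, a * b = 1).

Definition sle (S : comNzSemiRingType) (a b : S) : Prop := a + b = b.

Definition totally_ordered (S : comNzSemiRingType) : Prop :=
  forall a b : S, sle a b \/ sle b a.

(* An alias is needed because MathComp equips [bool] itself with the ring
   structure of the field with two elements, where 1 + 1 = 0. *)
Definition boolean_semifield : Type := bool.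
HB.instance Definition _ := Choice.copy boolean_semifield bool.
HB.instance Definition _ :=
  GRing.isNmodule.Build boolean_semifield orbA orbC orFb.
HB.instance Definition _ :=
  GRing.Nmodule_isComNzSemiRing.Build boolean_semifield
    andbA andbC andTb andb_orl andFb isT.

Lemma boolean_idempotent_semifield : idempotent_semifield boolean_semifield.
Proof.
by split=> [[] //|a a_neq0]; exists 1; case: a a_neq0.
Qed.

(** * Linear representations *)

(* Vectors of V = S^n are columns and linear endomorphisms act on them by
   [A *m p].  The two equations force every [rho g] to be invertible, so they
   say exactly that [rho] is a group homomorphism to GL(V). *)
Definition is_linear_rep (G : groupType) (S : comNzSemiRingType) (n : nat)
    (rho : G -> 'M[S]_n) : Prop :=
  rho 1%g = 1%:M /\ (forall g h : G, rho (g * h)%g = rho g *m rho h).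

(* Elements of the dual of V are also written as columns, of coordinates in the
   dual basis x_1, ..., x_n; see [dual_repE]. *)
Definition dual_rep (G : groupType) (S : comNzSemiRingType) (n : nat)
    (rho : G -> 'M[S]_n) (g : G) : 'M[S]_n := (rho g^-1%g)^T.

Definition pairing (S : comNzSemiRingType) (n : nat) (a p : 'cV[S]_n) : S :=
  \sum_i a i 0 * p i 0.

Lemma dual_repE (G : groupType) (S : comNzSemiRingType) (n : nat)
    (rho : G -> 'M[S]_n) (g : G) (a p : 'cV[S]_n) :
  pairing (dual_rep rho g *m a) p = pairing a (rho g^-1%g *m p).
Proof.
rewrite /pairing.
transitivity (\sum_i \sum_j a j 0 * rho g^-1%g j i * p i 0).
  apply: eq_bigr => i _; rewrite mxE mulr_suml.
  by apply: eq_bigr => j _; rewrite mxE [_ * a j 0]mulrC.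
rewrite exchange_big /=; apply: eq_bigr => j _; rewrite mxE mulr_sumr.
by apply: eq_bigr => i _; rewrite mulrA.
Qed.

Definition act_set (S : comNzSemiRingType) (n : nat) (A : 'M[S]_n)
    (T : set 'cV[S]_n) : set 'cV[S]_n := ((mulmx A) @` T)%classic.

Definition G_invariant (G : groupType) (S : comNzSemiRingType) (n : nat)
    (rho : G -> 'M[S]_n) (T : set 'cV[S]_n) : Prop :=
  forall g : G, act_set (rho g) T = T.

Definition is_action_on (G : groupType) (X : Type) (D : set X)
    (act : G -> X -> X) : Prop :=
  [/\ forall g x, D x -> D (act g x),
      forall x, D x -> act 1%g x = x &
      forall g h x, D x -> act (g * h)%g x = act g (act h x)].

(** * The exterior algebra *)

(* An element of the exterior algebra is the family of its coordinates in the
   basis (e_I), where I ranges over the subsets of [n].  Homogeneous elements of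
   degree d are those supported on the subsets with d elements.  The same type
   serves for the exterior algebra of the dual, with its basis (x_I). *)
Notation ext S n := {ffun {set 'I_n} -> S}.

Section Exterior.
Variables (S : comNzSemiRingType) (n : nat).
Implicit Types (u v w : ext S n) (I J K : {set 'I_n}).

Definition homog (d : nat) : set (ext S n) :=
  fun v => forall I, #|I| != d -> v I = 0.

Definition ext_basis I : ext S n := [ffun J => (J == I)%:R].

Definition ext_vec (p : 'cV[S]_n) : ext S n :=
  [ffun J : {set 'I_n} => \sum_(i | J == [set i]%SET) p i 0].

Definition ext_scale (a : S) v : ext S n := [ffun I => a * v I].

Definition wedge u w : ext S n :=
  [ffun K : {set 'I_n} => \sum_(I : {set 'I_n})
     \sum_(J : {set 'I_n} | [disjoint I & J] && (I :|: J == K)) u I * w J].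

(* The linear map sending each basis element e_I to the product, in the
   exterior algebra, of the vectors A e_i for i in I.  It is the map induced
   by A whenever A is monomial, see [ext_map_monomial]. *)
Definition ext_map (A : 'M[S]_n) v : ext S n :=
  [ffun J : {set 'I_n} => \sum_(I : {set 'I_n}) v I *
     (\big[wedge/ext_basis finset.set0]_(i in I) ext_vec (col i A)) J].

Definition star v : ext S n := [ffun I : {set 'I_n} => v (~: I)].

Lemma wedge_basis a b I J : [disjoint I & J] ->
  wedge (ext_scale a (ext_basis I)) (ext_scale b (ext_basis J)) =
  ext_scale (a * b) (ext_basis (I :|: J)).
Proof.
move=> dIJ; apply/ffunP => K.
rewrite ffunE (bigD1 I) //= [X in _ + X]big1 ?addr0; last first.
  move=> L /negPf neqLI; rewrite big1 // => M _.
  by rewrite !ffunE neqLI mulr0 mul0r.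
rewrite big_mkcond (bigD1 J) //= [X in _ + X]big1 ?addr0; last first.
  by move=> L /negPf neqLJ; case: ifP => // _; rewrite !ffunE neqLJ !mulr0.
rewrite dIJ !ffunE !eqxx !mulr1 /= eq_sym.
by case: eqP => _; rewrite ?mulr1 ?mulr0.
Qed.

Lemma wedge_basis0 a b I J : ~~ [disjoint I & J] ->
  wedge (ext_scale a (ext_basis I)) (ext_scale b (ext_basis J)) = 0.
Proof.
move=> dIJ; apply/ffunP => K; rewrite !ffunE big1 // => L _.
rewrite big1 // => M /andP[dLM _]; rewrite !ffunE.
case: eqP => [eLI|]; last by rewrite mulr0 mul0r.
case: eqP => [eMJ|]; last by rewrite !mulr0.
by move: dIJ; rewrite -eLI -eMJ dLM.
Qed.

Lemma ext_map_monomial (A : 'M[S]_n) (s : 'S_n) (l : 'I_n -> S) I :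
  (forall i, col i A = l i *: delta_mx (s i) 0) ->
  ext_map A (ext_basis I) =
  ext_scale (\prod_(i in I) l i) (ext_basis (s @: I)).
Proof.
move=> colA.
have vecE i : ext_vec (col i A) = ext_scale (l i) (ext_basis [set s i]%SET).
  apply/ffunP => J; rewrite !ffunE colA.
  rewrite big_mkcond (bigD1 (s i)) //= [X in _ + X]big1 ?addr0; last first.
    by move=> j /negPf neq; case: ifP => // _; rewrite !mxE neq mulr0.
  by rewrite !mxE !eqxx; case: eqP; rewrite ?mulr0.
have -> : ext_map A (ext_basis I) =
    \big[wedge/ext_basis finset.set0]_(i in I) ext_vec (col i A).
  apply/ffunP => J; rewrite ffunE (bigD1 I) //= big1 ?addr0.
    by rewrite ffunE eqxx mul1r.
  by move=> K /negPf neqKI; rewrite ffunE neqKI mul0r.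
rewrite -[LHS]big_filter -[\prod_(i in I) _]big_filter.
have [r _ [r_uniq mem_r] _] := big_enumP [in I].
have -> : s @: I = [set s i | i in r]%SET.
  apply/setP => j; apply/imsetP/imsetP => -[i ir ->]; exists i => //;
    by move: ir; rewrite mem_r.
elim: r r_uniq {mem_r} => [|i r IHr] /=.
  move=> _; rewrite !big_nil.
  have -> : [set s i | i in [::]]%SET = finset.set0.
    by apply/setP => j; rewrite !inE; apply/negbTE/imsetP => -[].
  by apply/ffunP => J; rewrite !ffunE mul1r.
case/andP=> i_notin_r r_uniq; rewrite !big_cons IHr // vecE wedge_basis.
  congr (ext_scale _ (ext_basis _)); apply/setP => j; rewrite !inE.
  apply/orP/imsetP => [[/eqP->|/imsetP[k kr ->]]|[k]].
  - by exists i; rewrite ?inE ?eqxx.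
  - by exists k; rewrite ?inE ?kr ?orbT.
  by rewrite inE => /orP[/eqP-> ->|kr ->]; [left|right; apply: imset_f].
rewrite disjoints1; apply/imsetP => -[k kr /perm_inj eik].
by rewrite eik kr in i_notin_r.
Qed.

End Exterior.

(** * Tropical linear spaces *)

Section Tropical.
Variables (S : comNzSemiRingType) (n : nat).
Implicit Types (v w : ext S n) (A B I J : {set 'I_n}) (T U : set 'cV[S]_n).

Definition is_plucker (d : nat) v : Prop :=
  [/\ v != 0, homog d v &
      forall A B (j : 'I_n), #|A| = d.+1 -> #|B|.+1 = d -> j \in A :\: B ->
        \sum_(i in A :\: B) v (A :\ i) * v (i |: B) =
        \sum_(i in (A :\: B) :\ j) v (A :\ i) * v (i |: B)].

(* Points of the projective space of the exterior algebra are the orbits of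
   nonzero elements under scaling by nonzero elements of S. *)
Definition pclass v : set (ext S n) :=
  [set w | exists2 a : S, a != 0 & w = ext_scale a v]%classic.

Definition dressian (d : nat) : set (set (ext S n)) :=
  [set pclass v | v in is_plucker d]%classic.

Definition hyperplane (a : 'cV[S]_n) : set 'cV[S]_n :=
  [set p | forall j : 'I_n,
     \sum_i a i 0 * p i 0 = \sum_(i | i != j) a i 0 * p i 0]%classic.

Definition plucker_form v A : 'cV[S]_n :=
  \col_i (if i \in A then v (A :\ i) else 0).

Definition tls (d : nat) v : set 'cV[S]_n :=
  [set p | forall A, #|A| = d.+1 -> hyperplane (plucker_form v A) p]%classic.

(* The tropical linear space of a point of the Dressian; the intersection is
   over representatives that all give the same set, see [tls_class_pclass]. *)
Definition tls_class (d : nat) (c : set (ext S n)) : set 'cV[S]_n :=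
  [set p | forall v, c v -> tls d v p]%classic.

Lemma tls_class_pclass (d : nat) v :
  tls_class d (pclass v) = tls d v.
Proof.
apply/seteqP; split=> [p Tp|p Tp w [a _ ->] A cA j].
  apply: Tp; exists 1; first exact: oner_neq0.
  by apply/ffunP => I; rewrite ffunE mul1r.
have E i : plucker_form (ext_scale a v) A i 0 * p i 0 =
           a * (plucker_form v A i 0 * p i 0).
  by rewrite !mxE; case: ifP => _; rewrite ?ffunE ?mul0r ?mulr0 ?mulrA.
rewrite (eq_bigr _ (fun i _ => E i)) [RHS](eq_bigr _ (fun i _ => E i)).
by rewrite -!mulr_sumr; congr (_ * _); exact: Tp.
Qed.

(* Dimension 0 (the zero space) is allowed here. *)
Definition is_tls T : Prop :=
  exists d v, is_plucker d v /\ T = tls d v.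

Definition is_stable_sum T T' U : Prop :=
  exists d d' v v',
    [/\ is_plucker d v /\ T = tls d v,
        is_plucker d' v' /\ T' = tls d' v',
        wedge v v' != 0 &
        U = tls (d + d')%N (wedge v v')].

(* [star v] and [star v'] have degrees n - d and n - d', so a nonzero
   [wedge (star v) (star v')] forces n <= d + d'. *)
Definition is_stable_intersection T T' U : Prop :=
  exists d d' v v',
    [/\ is_plucker d v /\ T = tls d v,
        is_plucker d' v' /\ T' = tls d' v',
        wedge (star v) (star v') != 0 &
        U = tls (d + d' - n)%N (star (wedge (star v) (star v')))].

(* A set of columns of dual coordinates. *)
Definition orthogonal_dual T : set 'cV[S]_n :=
  [set a | forall p, T p -> hyperplane p a]%classic.

Variables (G : groupType) (rho : G -> 'M[S]_n).

Definition tropical_rep T : Prop := is_tls T /\ G_invariant rho T.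

Definition tropical_rep_dim (d : nat) : set (set 'cV[S]_n) :=
  [set T | (exists2 v, is_plucker d v & T = tls d v) /\
           G_invariant rho T]%classic.

Definition ext_act (g : G) : ext S n -> ext S n := ext_map (rho g).

Definition class_act (g : G) (c : set (ext S n)) : set (ext S n) :=
  (ext_act g @` c)%classic.

Definition dressian_fixed (d : nat) : set (set (ext S n)) :=
  [set c | dressian d c /\ forall g, class_act g c = c]%classic.

End Tropical.

(** * Matroids *)

Record matroid (n : nat) := Matroid {
  bases : {set {set 'I_n}};
  bases_neq0 : bases != finset.set0;
  bases_exchange : forall I J i, I \in bases -> J \in bases -> i \in I :\: J ->
    exists2 j, j \in J :\: I & j |: (I :\ i) \in bases }.

Definition indep (n : nat) (M : matroid n) (J : {set 'I_n}) : bool :=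
  [exists I in bases M, J \subset I].

Definition matroid_aut (n : nat) (M : matroid n) : {set 'S_n} :=
  [set s : 'S_n | [forall J : {set 'I_n}, indep M J ==> indep M (s @: J)]]%SET.

(* The nonzero scalars of B reduce to 1, so [v], and with it the matroid below,
   is determined by the tropical linear space of [v]. *)
Section PluckerMatroid.
Variables (n d : nat) (v : ext boolean_semifield n) (v_plucker : is_plucker d v).

Definition plucker_bases : {set {set 'I_n}} := [set I | v I == 1]%SET.

Lemma plucker_bases_neq0 : plucker_bases != finset.set0.
Proof.
case: v_plucker => v0 _ _; apply: contraNneq v0 => b0; apply/eqP/ffunP => I.
have: I \notin plucker_bases by rewrite b0 inE.
by rewrite !inE ffunE; case: (v I).
Qed.

Lemma plucker_bases_exchange I J i :
  I \in plucker_bases -> J \in plucker_bases -> i \in I :\: J ->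
  exists2 j, j \in J :\: I & j |: (I :\ i) \in plucker_bases.
Proof.
case: v_plucker => _ hom rel; rewrite !inE => /eqP vI /eqP vJ /andP[iJ iI].
have card_of K : v K = 1 -> #|K| = d.
  by move=> vK; apply/eqP; apply: contraT => /hom; rewrite vK.
have cA : #|i |: J| = d.+1 by rewrite cardsU1 iJ (card_of _ vJ).
have cB : #|I :\ i|.+1 = d by rewrite -(card_of _ vI) (cardsD1 i I) iI.
have iAB : i \in (i |: J) :\: (I :\ i) by rewrite !inE eqxx.
have := rel _ _ _ cA cB iAB.
rewrite (big_setD1 i) //= finset.setU1K // finset.setD1K // vI vJ => E.
have [j /andP[jAB jv]|no] :=
  pickP (fun j => (j \in ((i |: J) :\: (I :\ i)) :\ i) &&
                  (v ((i |: J) :\ j) * v (j |: (I :\ i)) == 1)).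
  move: jAB; rewrite !inE; case: (j =P i) => //= neji /andP[jI jJ].
  exists j; first by rewrite !inE jI.
  by rewrite inE; move: jv; case: (v (_ :\ j)); case: (v (j |: _)).
suff E0 : \sum_(j in ((i |: J) :\: (I :\ i)) :\ i)
    v ((i |: J) :\ j) * v (j |: (I :\ i)) = 0 by rewrite E0 in E.
apply: big1 => j jAB; have := no j; rewrite jAB /=.
by case: (_ * _).
Qed.

Definition plucker_matroid : matroid n :=
  Matroid plucker_bases_neq0 plucker_bases_exchange.

End PluckerMatroid.

(* The automorphism of B^n with e_j |-> e_(s j), that is, the element of
   GL(B^n) corresponding to s; [perm_mx s] is its inverse on columns. *)
Definition perm_gl (n : nat) (s : 'S_n) : 'M[boolean_semifield]_n :=
  \matrix_(i, j) (i == s j)%:R.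

(* In MathComp [s * t] is s followed by t. *)
Lemma perm_glM (n : nat) (s t : 'S_n) :
  perm_gl (s * t)%g = perm_gl t *m perm_gl s.
Proof.
apply/matrixP => i j; rewrite !mxE (bigD1 (s j)) //= [X in _ + X]big1 ?addr0.
  by rewrite !mxE permM eqxx mulr1.
by move=> k /negPf neq; rewrite !mxE neq mulr0.
Qed.

(** * Valuations and tropicalization *)

Definition is_valuation (k : fieldType) (S : comNzSemiRingType) (nu : k -> S) :
    Prop :=
  [/\ nu 0 = 0, nu 1 = 1, nu (-1) = 1,
      (forall a b, nu (a * b) = nu a * nu b) &
      (forall a b, nu (a + b) + nu a + nu b = nu a + nu b)].

Definition is_monomial (k : fieldType) (n : nat) (A : 'M[k]_n) : Prop :=
  (forall i, exists! j, A i j != 0) /\ (forall j, exists! i, A i j != 0).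

Definition is_submodule (S : comNzSemiRingType) (n : nat)
    (M : set 'cV[S]_n) : Prop :=
  [/\ M 0, (forall p q, M p -> M q -> M (p + q)) &
      (forall a p, M p -> M (a *: p))].

Definition trop (k : fieldType) (S : comNzSemiRingType) (nu : k -> S) (n : nat)
    (L : {vspace 'cV[k]_n}) : set 'cV[S]_n :=
  smallest (@is_submodule S n) [set map_mx nu w | w in [set` L]]%classic.

Definition act_vspace (k : fieldType) (n : nat) (A : 'M[k]_n)
    (L : {vspace 'cV[k]_n}) : {vspace 'cV[k]_n} := (linfun (mulmx A) @: L)%VS.

(* Main.v *)
(* A linear automorphism over an idempotent semifield is monomial, so it acts on
   Pluecker vectors by permuting and rescaling coordinates, and every invariance
   statement reduces to this coordinate action once two facts are known: T_v
   determines v up to scaling, and T_v is spanned by the vectors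
   sum_i v_(B + i) e_i with #|B| = d - 1, which themselves lie in T_v because of
   the Pluecker relations.  The second fact holds over every idempotent
   semifield; it yields T_v^perp = T_(star v), and trop L = T_v when v is the
   family of valuations of the maximal minors of a basis of L.  That v /\ v' is
   again a Pluecker vector is proved by forming the direct sum of v and v' on two
   copies of [n] and then identifying the two copies of each element, one element
   at a time. *)
Require Import Defs.
From mathcomp Require Import all_boot all_fingroup all_algebra.
From mathcomp Require Import boolp classical_sets functions.

Set Implicit Arguments.
Unset Strict Implicit.
Unset Printing Implicit Defensive.

Import GRing.Theory.
Local Open Scope ring_scope.
Local Notation "a <<= b" := (sle a b) (at level 70).

(** * The order of an idempotent semifield *)

(** Addition is a join, so a relation that allows one term to be dropped becomes a bound of that
    term by the rest. The order is only partial: no maximal term can be selected. Where one would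
    choose a basis of maximal weight, [tls_span] divides by the join of all relevant weights; where
    one would compare two terms, [merge_exchange] bounds two products at once through their product
    ([quadratic_bound]). Merging one pair at a time keeps that argument to four products, while the
    wedge relation itself involves all splittings of A and B. Proportionality of two vectors with
    the same linear space travels from basis to basis, each step reading a relation with at most two
    nonzero terms. The Pluecker relations of valuated minors come from realizing each cocircuit as
    the valuation of a vector of L. *)

Section IdempotentOrder.
Variables (S : comNzSemiRingType) (hS : idempotent_semifield S).
Implicit Types a b c d : S.

Lemma sle_refl a : a <<= a.
Proof. exact: hS.1. Qed.

Lemma sle_trans b a c : a <<= b -> b <<= c -> a <<= c.
Proof. by rewrite /sle => ab bc; rewrite -bc addrA ab. Qed.

Lemma sle_anti a b : a <<= b -> b <<= a -> a = b.
Proof. by rewrite /sle => ab ba; rewrite -ab addrC. Qed.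

Lemma sle0 a : 0 <<= a.
Proof. exact: add0r. Qed.

Lemma sle_eq0 a : a <<= 0 -> a = 0.
Proof. by rewrite /sle addr0. Qed.

Lemma sleDl a b : a <<= a + b.
Proof. by rewrite /sle addrA hS.1. Qed.

Lemma sleDr a b : b <<= a + b.
Proof. by rewrite addrC; apply: sleDl. Qed.

Lemma sle_add a b c : a <<= c -> b <<= c -> a + b <<= c.
Proof. by rewrite /sle => ac bc; rewrite -addrA bc. Qed.

Lemma sleD2 a b c d : a <<= b -> c <<= d -> a + c <<= b + d.
Proof. by rewrite /sle => ab cd; rewrite addrACA ab cd. Qed.

Lemma sleM2l c a b : a <<= b -> c * a <<= c * b.
Proof. by rewrite /sle -mulrDr => ->. Qed.

Lemma sleM2r c a b : a <<= b -> a * c <<= b * c.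
Proof. by rewrite /sle -mulrDl => ->. Qed.

Lemma sleM a b c d : a <<= b -> c <<= d -> a * c <<= b * d.
Proof. by move=> ab cd; apply: sle_trans (sleM2r c ab) (sleM2l b cd). Qed.

Lemma sle_sum (I : finType) (P : pred I) (F : I -> S) b :
  (forall i, P i -> F i <<= b) -> \sum_(i | P i) F i <<= b.
Proof.
by move=> Fb; elim/big_ind: _ => [|x y|//]; [exact: sle0|exact: sle_add].
Qed.

Lemma sle_bigl (I : finType) (P : pred I) (F : I -> S) i a :
  P i -> a <<= F i -> a <<= \sum_(i | P i) F i.
Proof. by move=> Pi aF; rewrite (bigD1 i) //=;
  apply: sle_trans aF (sleDl _ _). Qed.

Lemma sle_sum2 (I J : finType) (P : pred I) (Q : pred J)
    (F : I -> S) (E : J -> S) :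
  (forall i, P i -> exists2 j, Q j & F i <<= E j) ->
  \sum_(i | P i) F i <<= \sum_(j | Q j) E j.
Proof. by move=> FE; apply: sle_sum => i /FE[j Qj]; apply: sle_bigl. Qed.

Lemma sum_const (I : finType) (P : pred I) (F : I -> S) a i :
  P i -> (forall j, P j -> F j = a) -> \sum_(j | P j) F j = a.
Proof.
move=> Pi Fa; apply: sle_anti; first by apply: sle_sum => j /Fa->;
  apply: sle_refl.
by apply: (sle_bigl Pi); rewrite Fa //; apply: sle_refl.
Qed.

Lemma psum_eq0 (I : finType) (P : pred I) (F : I -> S) i :
  \sum_(i | P i) F i = 0 -> P i -> F i = 0.
Proof. by move=> F0 Pi; apply: sle_eq0; rewrite -F0;
  apply: sle_bigl (sle_refl _). Qed.

Lemma neq0_sum (I : finType) (P : pred I) (F : I -> S) :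
  \sum_(i | P i) F i != 0 -> exists2 i, P i & F i != 0.
Proof.
move=> F0; have [i /andP[Pi Fi]|no] := pickP (fun i => P i && (F i != 0)).
  by exists i.
by case/eqP: F0; apply: big1 => i Pi; have := no i; rewrite Pi => /negbFE/eqP.
Qed.

(** Only existence of inverses is assumed, so one is chosen classically; at 0 the value is the
    default 0. *)
Definition sinv a : S := if pselect (exists b, a * b =
  1) is left h then sval (cid h) else 0.

Lemma mulVs a : a != 0 -> a * sinv a = 1.
Proof.
move=> /hS.2 h; rewrite /sinv; case: pselect => [h'|/(_ h)//].
by case: (cid h').
Qed.

Lemma mulsI c a b : c != 0 -> c * a = c * b -> a = b.
Proof.
move=> c0 E; have := congr1 ( *%R (sinv c)) E.
by rewrite !mulrA [_ * c]mulrC mulVs // !mul1r.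
Qed.

Lemma muls_neq0 a b : a != 0 -> b != 0 -> a * b != 0.
Proof.
by move=> a0; apply: contraNneq => ab0; apply/eqP/(mulsI a0); rewrite ab0 mulr0.
Qed.

Lemma sinv_neq0 a : a != 0 -> sinv a != 0.
Proof.
move=> a0; apply/eqP => E; have := mulVs a0.
by rewrite E mulr0 => /eqP; rewrite eq_sym oner_eq0.
Qed.

Lemma sinvK a : a != 0 -> sinv (sinv a) = a.
Proof.
move=> a0; apply: (mulsI (sinv_neq0 a0)).
by rewrite mulVs ?sinv_neq0 // mulrC mulVs.
Qed.

Lemma sinvMr a b : a != 0 -> b != 0 -> sinv (a * b) * b = sinv a.
Proof.
move=> a0 b0; apply: (mulsI a0).
by rewrite mulVs // mulrCA [LHS]mulrC mulVs // muls_neq0.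
Qed.

Lemma sle_mul2l c a b : c != 0 -> c * a <<= c * b -> a <<= b.
Proof. by rewrite /sle -mulrDr => c0 E; apply: (mulsI c0). Qed.

Lemma sprod_neq0 (I : finType) (P : pred I) (F : I -> S) :
  (forall i, P i -> F i != 0) -> \prod_(i | P i) F i != 0.
Proof.
move=> F0; elim/big_ind: _ => //; first exact: oner_neq0.
exact: muls_neq0.
Qed.

(* The order-theoretic content of "the maximum is attained twice". *)
Definition vanishing (I : finType) (x : I -> S) : Prop :=
  forall j, x j <<= \sum_(i | i != j) x i.

Lemma vanishingE n (a p : 'cV[S]_n) :
  hyperplane a p <-> vanishing (fun i => a i 0 * p i 0).
Proof.
have E j : \sum_i a i 0 * p i 0 =
  a j 0 * p j 0 + \sum_(i | i != j) a i 0 * p i 0.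
  by rewrite (bigD1 j).
by split=> H j; have := H j; rewrite /sle (E j).
Qed.

Lemma eq_vanishing (I : finType) (x y : I -> S) :
  x =1 y -> vanishing x -> vanishing y.
Proof.
by move=> xy H j; rewrite -xy -(eq_bigr _ (fun i _ => xy i)); apply: H.
Qed.

Lemma vanishing_scale (I : finType) (x : I -> S) c :
  vanishing x -> vanishing (fun i => c * x i).
Proof. by move=> H j; rewrite -mulr_sumr; apply: sleM2l. Qed.

Lemma vanishing_scaleI (I : finType) (x : I -> S) c :
  c != 0 -> vanishing (fun i => c * x i) -> vanishing x.
Proof. by move=> c0 H j; apply: (sle_mul2l c0); rewrite mulr_sumr;
  apply: H. Qed.

Lemma vanishing_perm (I : finType) (x : I -> S) (s : {perm I}) :
  vanishing (fun i => x (s i)) <-> vanishing x.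
Proof.
split=> H j.
  rewrite (reindex_perm s) /= -{1}(permKV s j) (eq_bigl (fun i =>
    i != (s^-1%g j))).
    exact: H.
  by move=> i /=; rewrite (can2_eq (permK s) (permKV s)).
have := H (s j); rewrite (reindex_perm s) /= (eq_bigl (fun i => i != j)) //.
by move=> i; rewrite (inj_eq perm_inj).
Qed.

Lemma hyperplane_submodule n (a : 'cV[S]_n) : is_submodule (hyperplane a).
Proof.
split=> [j|p q /vanishingE Hp /vanishingE Hq|c p /vanishingE Hp].
- by rewrite !big1 // => i _; rewrite mxE mulr0.
- apply/vanishingE => j /=; rewrite mxE mulrDr.
  under eq_bigr do rewrite mxE mulrDr.
  by rewrite big_split /=; apply: sleD2.
- apply/vanishingE => j /=; rewrite mxE mulrCA.
  by under eq_bigr do rewrite mxE mulrCA; rewrite -mulr_sumr; apply: sleM2l.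
Qed.

Lemma submodule_sum n (M : set 'cV[S]_n) (I : finType) (P : pred I)
    (F : I -> 'cV[S]_n) :
  is_submodule M -> (forall i, P i -> M (F i)) -> M (\sum_(i | P i) F i).
Proof. by case=> M0 MD _ MF; elim/big_ind: _ => //; apply: MD. Qed.

End IdempotentOrder.

(** * Exchange relations and the exterior product *)

Section Exchange.
Variables (S : comNzSemiRingType) (hS : idempotent_semifield S).

(** The Pluecker relation at j as a bound on its j-th term. Without cardinality conditions and over
    any finite type, it makes sense on two copies of [n]; homogeneity restores the conditions in
    [is_pluckerE]. *)
Definition exchange (T : finType) (u : {set T} -> S) : Prop :=
  forall (A B : {set T}) j, j \in A -> j \notin B ->
  u (A :\ j) * u (j |: B) <<=
  \sum_(i | [&& i \in A, i \notin B & i != j]) u (A :\ i) * u (i |: B).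

(** The hypotheses give [x * x <<= x * r + r * r], so [(x + r) * (x + r) <<= (x + r) * r], and the
    factor [x + r] cancels unless it is 0. *)
Lemma quadratic_bound (x y r : S) : x <<= r + y -> x * y <<= r * r -> x <<= r.
Proof.
move=> xry xyr; have [E|ne] := eqVneq (x + r) 0.
  have -> : x = 0 by apply: (sle_eq0); rewrite -E; apply: sleDl.
  exact: sle0.
apply: (sle_trans (sleDl hS x r)); apply: (sle_mul2l hS ne).
rewrite [_ * r]mulrC mulrDl mulrDr !mulrDr; apply: sle_add; last first.
  by rewrite [r * x]mulrC; apply: sle_refl.
apply: sle_add; last by rewrite mulrC; apply: sleDl.
apply: sle_trans (sleM2l x xry) _; rewrite mulrDr [r * x]mulrC.
by apply: sleD2 => //; apply: sle_refl.
Qed.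

(** * Identifying two elements of the ground set *)

Section Merge.
Variables (T : finType) (a b : T) (u : {set T} -> S).
Hypotheses (neq_ab : a != b) (u_exch : exchange u).

(* Pushes u forward along the map identifying a with b; a becomes a loop. *)
Definition merge (X : {set T}) : S :=
  if a \in X then 0 else if b \in X then u X + u (a |: X :\ b) else u X.

Lemma le_merge (X : {set T}) : a \notin X -> u X <<= merge X.
Proof.
rewrite /merge => /negbTE->; case: ifP => _; [exact: sleDl|exact: sle_refl].
Qed.

Lemma le_merge_swap (X Y : {set T}) :
  a \notin X -> b \in X -> Y = a |: X :\ b -> u Y <<= merge X.
Proof. by rewrite /merge => /negbTE-> -> ->; apply: sleDr. Qed.

Lemma merge_exchange : exchange merge.
Proof.
move=> A B j jA jB.
have [aA|aA] := boolP (a \in A).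
  have [aj|neaj] := eqVneq a j.
    by rewrite [merge (j |: B)]/merge !inE aj eqxx /= mulr0; apply: sle0.
  by rewrite [merge (A :\ j)]/merge !inE neaj aA /= mul0r; apply: sle0.
have [aB|aB] := boolP (a \in B).
  by rewrite [merge (j |: B)]/merge !inE aB orbT /= mulr0; apply: sle0.
have neA i : i \in A -> i != a by apply: contraTneq => ->.
have aDA i : a \notin A :\ i by rewrite !inE (negbTE aA) andbF.
have aUB i : i \in A -> a \notin i |: B.
  by move=> /neA nia; rewrite !inE negb_or eq_sym nia.
have nja := neA _ jA.
set R := \sum_(i | _) _.
have le_R i X : [&& i \in A, i \notin B & i != j] ->
    X <<= merge (A :\ i) * merge (i |: B) -> X <<= R.
  by move=> Pi; apply: (sle_bigl hS (i := i)).
have base : u (A :\ j) * u (j |: B) <<= R.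
  apply: sle_trans (u_exch jA jB) _; apply: sle_sum => i /and3P[iA iB nij].
  apply: (le_R i); first by rewrite iA iB.
  by apply: sleM; apply: le_merge; rewrite ?aDA ?aUB.
(* A merged coordinate at a set containing b also sees the set with b replaced by a; [A'] and [B']
   are A and B after this replacement. *)
pose A' := a |: A :\ b; pose B' := a |: B :\ b.
have [bA|bA] := boolP (b \in A); have [bB|bB] := boolP (b \in B).
(* With b in both sets, the merged product at j expands into two unmixed products, over A, B and
   over [A'], [B'], and two mixed ones. *)
- have njb : j != b by apply: contraNneq jB => ->.
  have jA' : j \in A' by rewrite !inE njb jA orbT.
  have jB' : j \notin B' by rewrite !inE negb_or nja negb_and jB orbT.
  have aA' : a \in A' by rewrite !inE eqxx.
  have bB' : b \notin B' by rewrite !inE eqxx orbF eq_sym.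
  have bDA i : i != b -> b \in A :\ i by rewrite !inE bA eq_sym => ->.
  have bUB i : b \in i |: B by rewrite !inE bB orbT.
  have nib i : i \notin B -> i != b by apply: contraNneq => ->.
  have swA i : i != b -> i != a -> A' :\ i = a |: A :\ i :\ b.
    by move=> ib ia; rewrite /A'; apply/setP=> x; rewrite !inE;
      have [->|] := eqVneq x a;
      rewrite ?[a == i]eq_sym ?ia //= andbCA.
  have swB i : i != b -> i |: B' = a |: (i |: B) :\ b.
    move=> ib; rewrite /B'; apply/setP=> x; rewrite !inE.
    by have [->|] := eqVneq x i; rewrite ?ib ?orbT ?orTb //=.
  (* The index b in the exchange for A, [B'] and the index a in the exchange for [A'], B give the
     same product, so one z serves both mixed terms. *)
  have z_eq : u (A :\ b) * u (b |: B') = u (A' :\ a) * u (a |: B).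
    congr (u _ * u _); apply/setP => x; rewrite !inE.
      by have [->|] := eqVneq x a; rewrite /= ?(negbTE aA) ?andbF.
    by have [->|] := eqVneq x b; rewrite ?orbT ?bB ?orbT.
  set z := u (A :\ b) * u (b |: B') in z_eq.
  have x_mid i : i \in A -> i \notin B -> i != j ->
      u (A :\ i) * u (i |: B') <<= R.
    move=> iA iB ij; apply: (le_R i); first by rewrite iA iB.
    by apply: sleM; [apply: le_merge|apply: le_merge_swap;
      rewrite ?aUB ?swB ?nib].
  have y_mid i : i \in A -> i \notin B -> i != j ->
      u (A' :\ i) * u (i |: B) <<= R.
    move=> iA iB ij; apply: (le_R i); first by rewrite iA iB.
    apply: sleM; last by apply: le_merge; rewrite aUB.
    by apply: le_merge_swap; rewrite ?aDA ?bDA ?swA ?nib ?neA.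
  have inB' i : i \notin B' -> i != b -> i \notin B.
    by rewrite !inE negb_or negb_and negbK => /andP[_ /orP[->|]].
  have inA' i : i \in A' -> i != a -> i \in A.
    by rewrite !inE => /orP[->//|/andP[]].
  (* The two mixed products x and y at j can each be matched only up to a term
     z, itself bounded by either of them up to R; as x * y <= R * R, both are at
     most R. *)
  set x := u (A :\ j) * u (j |: B').
  set y := u (A' :\ j) * u (j |: B).
  have xz : x <<= R + z.
    apply: sle_trans (u_exch jA jB') _; apply: sle_sum => i /and3P[iA iB ij].
    have [->|ib] := eqVneq i b; first exact: sleDr.
    by apply: sle_trans (sleDl hS _ _); apply: x_mid; rewrite ?inB'.
  have zx : z <<= R + x.
    apply: sle_trans (u_exch bA bB') _; apply: sle_sum => i /and3P[iA iB ib].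
    have [->|ij] := eqVneq i j; first exact: sleDr.
    by apply: sle_trans (sleDl hS _ _); apply: x_mid; rewrite ?inB'.
  have yz : y <<= R + z.
    apply: sle_trans (u_exch jA' jB) _; apply: sle_sum => i /and3P[iA iB ij].
    have [->|ia] := eqVneq i a; first by rewrite z_eq; apply: sleDr.
    by apply: sle_trans (sleDl hS _ _); apply: y_mid; rewrite ?inA'.
  have zy : z <<= R + y.
    rewrite z_eq.
    apply: sle_trans (u_exch aA' aB) _; apply: sle_sum => i /and3P[iA iB ia].
    have [->|ij] := eqVneq i j; first exact: sleDr.
    by apply: sle_trans (sleDl hS _ _); apply: y_mid; rewrite ?inA'.
  (* [A'] and [B'] both contain a and miss b, so every index of this exchange is an index of R. *)
  have last_le : u (A' :\ j) * u (j |: B') <<= R.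
    apply: sle_trans (u_exch jA' jB') _; apply: sle_sum => i /and3P[iA iB ij].
    have ia : i != a by apply: contraNneq iB => ->; rewrite !inE eqxx.
    have ib : i != b.
      by apply: contraTneq iA => ->; rewrite !inE eqxx orbF eq_sym.
    apply: (le_R i); first by rewrite inA' // inB'.
    apply: sleM; apply: le_merge_swap; rewrite ?aDA ?bDA ?swA ?swB //.
    by rewrite aUB // inA'.
  (* Regrouping the four factors gives the two unmixed products, bounded by [base] and [last_le]. *)
  have xy : x * y <<= R * R.
    by rewrite /x /y mulrACA [u (j |: B') * _]mulrC mulrACA; apply: sleM.
  have xy' : y * x <<= R * R by rewrite mulrC.
  have step p q : p <<= R + z -> z <<= R + q -> p <<= R + q.
    by move=> pz zq; apply: sle_trans pz (sle_add (sleDl hS _ _) zq).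
  have xR : x <<= R by apply: quadratic_bound xy; apply: step zy.
  have yR : y <<= R by apply: quadratic_bound xy'; apply: step zx.
  rewrite /merge (negbTE (aDA _)) bDA // (negbTE (aUB _ jA)) bUB.
  rewrite -swA // -swB // mulrDl !mulrDr.
  by do 2!apply: sle_add.
(* Only A contains b. For [j = b] the extra term is exchanged at a, since [A'] without a is A
   without b; for other j, the index a may occur in the exchange, and its term is charged to the
   index b of R. *)
- have aA' : a \in A' by rewrite !inE eqxx.
  have A'a : A' :\ a = A :\ b.
    by apply/setP => x; rewrite !inE; have [->|] := eqVneq x a;
      rewrite /= ?(negbTE aA) ?andbF.
  have main i : i \in A' -> i \notin B -> i != j -> i != a -> i != b ->
      u (A' :\ i) * u (i |: B) <<= R.
    rewrite !inE => /orP[->//|/andP[_ iA]] iB ij ia ib.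
    apply: (le_R i); first by rewrite iA iB.
    apply: sleM; last by apply: le_merge; rewrite aUB.
    apply: le_merge_swap; rewrite ?aDA ?inE ?[b == i]eq_sym ?ib //.
    by apply/setP=> x; rewrite !inE; have [->|] := eqVneq x a;
      rewrite ?[a == i]eq_sym ?ia //= andbCA.
  have bA' i : i \in A' -> i != b.
    by apply: contraTneq => ->; rewrite !inE eqxx orbF eq_sym.
  have [ejb|njb] := eqVneq j b.
    have -> : merge (A :\ j) = u (A :\ j).
      by rewrite /merge (negbTE (aDA _)) !inE ejb eqxx.
    have -> : merge (j |: B) = u (j |: B) + u (a |: B).
      rewrite /merge (negbTE (aUB _ jA)) !inE ejb eqxx /=; congr (_ + u _).
      by apply/setP => x; rewrite !inE; have [->|] := eqVneq x b;
        rewrite //= (negbTE bB).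
    rewrite mulrDr; apply: sle_add => //.
    rewrite ejb -A'a; apply: sle_trans (u_exch aA' aB) _.
    apply: sle_sum => i /and3P[iA' iB ia].
    by apply: main; rewrite ?bA' // ejb bA'.
  have jA' : j \in A' by rewrite !inE njb jA orbT.
  have -> : merge (j |: B) = u (j |: B).
    by rewrite /merge (negbTE (aUB _ jA)) !inE eq_sym (negbTE njb) (negbTE bB).
  have -> : merge (A :\ j) = u (A :\ j) + u (A' :\ j).
    rewrite /merge (negbTE (aDA _)) !inE eq_sym njb bA /=; congr (_ + u _).
    by apply/setP=> x; rewrite !inE; have [->|] := eqVneq x a;
      rewrite ?[a == j]eq_sym ?nja //= andbCA.
  rewrite mulrDl; apply: sle_add => //.
  apply: sle_trans (u_exch jA' jB) _.
  apply: sle_sum => i /and3P[iA' iB ij].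
  have [->|ia] := eqVneq i a; last by apply: main; rewrite ?bA'.
  rewrite A'a; apply: (le_R b); first by rewrite bA bB eq_sym.
  apply: sleM; first exact: le_merge.
  apply: le_merge_swap; rewrite ?aUB ?inE ?eqxx //.
  by apply/setP => x; rewrite !inE; have [->|] := eqVneq x b;
    rewrite //= (negbTE bB).
- have njb : j != b by apply: contraNneq jB => ->.
  have jB' : j \notin B' by rewrite !inE negb_or nja negb_and jB orbT.
  have -> : merge (A :\ j) = u (A :\ j).
    by rewrite /merge (negbTE (aDA _)) !inE (negbTE bA) andbF.
  have swB i : i != b -> i |: B' = a |: (i |: B) :\ b.
    move=> ib; rewrite /B'; apply/setP=> x; rewrite !inE.
    by have [->|] := eqVneq x i; rewrite ?ib ?orbT ?orTb //=.
  have -> : merge (j |: B) = u (j |: B) + u (j |: B').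
    by rewrite /merge (negbTE (aUB _ jA)) !inE bB orbT swB.
  rewrite mulrDr; apply: sle_add => //.
  apply: sle_trans (u_exch jA jB') _.
  apply: sle_sum => i /and3P[iA iB' ij].
  have ib : i != b by apply: contraNneq bA => <-.
  apply: (le_R i).
    by move: iB';
      rewrite iA ij andbT !inE negb_or negb_and negbK (negbTE ib) => /andP[_].
  apply: sleM; first exact: le_merge.
  by apply: le_merge_swap; rewrite ?aUB ?swB // !inE bB orbT.
- have -> : merge (A :\ j) = u (A :\ j).
    by rewrite /merge (negbTE (aDA _)) !inE (negbTE bA) andbF.
  have -> // : merge (j |: B) = u (j |: B).
  rewrite /merge (negbTE (aUB _ jA)) !inE (negbTE bB) orbF.
  by case: eqP bA => // ->; rewrite jA.
Qed.

End Merge.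

Section DirectSum.
Variables (T1 T2 : finType) (v : {set T1} -> S) (w : {set T2} -> S).
Hypotheses (v_exch : exchange v) (w_exch : exchange w).

Definition direct_sum (X : {set T1 + T2}) : S :=
  v (inl @^-1: X) * w (inr @^-1: X).

(** Exchange at an element of one copy stays in that copy; the coordinate of the other vector is a
    constant factor. *)
Lemma direct_sum_exchange : exchange direct_sum.
Proof.
have inlD X i : inl @^-1: (X :\ (inl i : T1 + T2)) = (inl @^-1: X) :\ i.
  by apply/setP => x; rewrite !inE.
have inrD X i : inr @^-1: (X :\ (inr i : T1 + T2)) = (inr @^-1: X) :\ i.
  by apply/setP => x; rewrite !inE.
have inlU X i : inl @^-1: ((inl i : T1 + T2) |: X) = i |: (inl @^-1: X).
  by apply/setP => x; rewrite !inE.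
have inrU X i : inr @^-1: ((inr i : T1 + T2) |: X) = i |: (inr @^-1: X).
  by apply/setP => x; rewrite !inE.
have inlDr X i : inl @^-1: (X :\ (inr i : T1 + T2)) = inl @^-1: X.
  by apply/setP => x; rewrite !inE.
have inrDl X i : inr @^-1: (X :\ (inl i : T1 + T2)) = inr @^-1: X.
  by apply/setP => x; rewrite !inE.
have inlUr X i : inl @^-1: ((inr i : T1 + T2) |: X) = inl @^-1: X.
  by apply/setP => x; rewrite !inE.
have inrUl X i : inr @^-1: ((inl i : T1 + T2) |: X) = inr @^-1: X.
  by apply/setP => x; rewrite !inE.
rewrite /direct_sum => A B [] j jA jB.
  rewrite inlD inlU inrDl inrUl mulrACA.
  have jA1 : j \in inl @^-1: A by rewrite inE.
  have jB1 : j \notin inl @^-1: B by rewrite inE.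
  apply: sle_trans (sleM2r _ (v_exch jA1 jB1)) _; rewrite mulr_suml.
  apply: sle_sum2 => // i; rewrite !inE => Pi; exists (inl i) => //.
  by rewrite inlD inlU inrDl inrUl mulrACA; apply: sle_refl.
rewrite inrD inrU inlDr inlUr mulrACA.
have jA1 : j \in inr @^-1: A by rewrite inE.
have jB1 : j \notin inr @^-1: B by rewrite inE.
apply: sle_trans (sleM2l _ (w_exch jA1 jB1)) _; rewrite mulr_sumr.
apply: sle_sum2 => // i; rewrite !inE => Pi; exists (inr i) => //.
by rewrite inrD inrU inlDr inlUr mulrACA; apply: sle_refl.
Qed.

End DirectSum.

(** * Push-forward along the codiagonal *)

Section Codiagonal.
Variables (T : finType) (u : {set T + T} -> S).

Definition merges (s : seq T) : {set T + T} -> S :=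
  foldr (fun k => merge (inr k) (inl k)) u s.

(** Each merge lets an element k of X stay in the first copy or move to the second, so the iterated
    merge sums over the set K of moved elements. The condition on [inr k] keeps X clear of the loops
    created by merging. *)
Lemma mergesE (s : seq T) (X : {set T + T}) : uniq s ->
  (forall k, k \in s -> inr k \notin X) ->
  merges s X = \sum_(K : {set T} | K \subset [set k in s | inl k \in X]%SET)
    u ((X :\: inl @: K) :|: inr @: K).
Proof.
elim: s X => [|k s IHs] X /=.
  move=> _ _; rewrite (big_pred1 finset.set0) => [|K]; last first.
    have -> : [set k in [::] | inl k \in X]%SET = finset.set0 :> {set T}.
      by apply/setP => x; rewrite !inE.
    by rewrite finset.subset0.
  by rewrite !imset0 finset.setD0 finset.setU0.
case/andP=> ks us Xs.
have kX := Xs k (mem_head _ _).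
have Xs' l : l \in s -> inr l \notin X by move=> ls; apply: Xs;
  rewrite inE ls orbT.
rewrite {1}/merge (negbTE kX); case: ifP => kX'; last first.
  suff -> : [set l in k :: s | inl l \in X]%SET =
    [set l in s | inl l \in X]%SET.
    exact: IHs.
  apply/setP => x; rewrite !inE.
  by have [->|] := eqVneq x k; rewrite //= kX' (negbTE ks).
rewrite !IHs //; last first.
  move=> l ls; rewrite !inE (negbTE (Xs' _ ls)) andbF orbF.
  by apply: contraNneq ks => -[<-].
set E := [set l in s | inl l \in X]%SET.
have -> : [set l in s | inl l \in inr k |: X :\ inl k]%SET = E.
  apply/setP => x; rewrite !inE /=.
  have [->|nxk] := eqVneq x k; first by rewrite (negbTE ks).
  by rewrite (inj_eq inl_inj) nxk.
have -> : [set l in k :: s | inl l \in X]%SET = k |: E.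
  by apply/setP => x; rewrite !inE; have [->|] := eqVneq x k; rewrite //= kX'.
have kE : k \notin E by rewrite inE (negbTE ks).
rewrite [RHS](bigID (fun K : {set T} => k \in K)) /= addrC; congr (_ + _).
  apply: eq_bigl => K; apply/idP/andP => [KE|[KE kK]].
    split; first by apply: fintype.subset_trans KE (finset.subsetUr _ _).
    by apply: contra kE; apply: (fintype.subsetP KE).
  apply/fintype.subsetP => x xK; have := fintype.subsetP KE x xK; rewrite !inE.
  by case/orP=> // /eqP ex; rewrite -ex xK in kK.
rewrite [RHS](reindex_onto (fun K : {set T} => k |: K) (fun K => K :\ k)) /=;
  last first.
  by move=> K /andP[_ kK]; rewrite finset.setD1K.
apply: eq_big => K.
  apply/idP/idP => [KE|/andP[/andP[KE _] /eqP EK]].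
    rewrite finset.setUS // setU11 /=; apply/eqP/finset.setU1K.
    by apply: contra kE; apply: (fintype.subsetP KE).
  apply/fintype.subsetP => x xK; move: xK; rewrite -EK !inE => /andP[xk].
  rewrite (negbTE xk) /= => xK; have := fintype.subsetP KE x.
  by rewrite !inE xK (negbTE xk) orbT; apply.
move=> KE; congr u; apply/setP => -[] x.
  rewrite !inE /= !(finset.mem_imset _ _ inl_inj).
  rewrite !inE (inj_eq inl_inj) negb_or.
  have -> : (inl x \in inr @: K) = false by apply/negbTE/imsetP => -[].
  have -> : (inl x \in inr @: (k |: K)) = false by apply/negbTE/imsetP => -[].
  by rewrite !orbF andbCA andbA.
rewrite !inE /=.
have inr_notin (L : {set T}) : (inr x \in [set inl y | y in L]%SET) = false.
  by apply/negbTE/imsetP => -[].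
rewrite !inr_notin !(finset.mem_imset _ _ inr_inj).
by rewrite !inE /= (inj_eq inr_inj) orbCA orbA.
Qed.

Lemma merges_exchange (s : seq T) : exchange u -> exchange (merges s).
Proof. by move=> u_exch; elim: s => //= k s IHs; apply: merge_exchange. Qed.

End Codiagonal.

Lemma wedgeE n (v w : ext S n) C :
  wedge v w C = \sum_(K : {set 'I_n} | K \subset C) v (C :\: K) * w K.
Proof.
rewrite ffunE (exchange_big_dep (fun K : {set 'I_n} => K \subset C)) /=;
  last first.
  by move=> I K _ /andP[_ /eqP <-]; apply: finset.subsetUr.
apply: eq_bigr => K KC; apply: big_pred1 => I /=.
apply/andP/eqP => [[dIK /eqP <-]|->].
  apply/setP => x; rewrite !inE; have := fintype.disjointFr dIK (x := x).
  by case: (x \in I) => [->|] //; case: (x \in K).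
split; first by rewrite finset.disjoints_subset; apply/fintype.subsetP => x;
  rewrite !inE => /andP[].
apply/eqP/setP => x; rewrite !inE; have := fintype.subsetP KC x.
by case: (x \in K) => // [-> //|_]; rewrite orbF.
Qed.

(** Once all pairs are merged, the moved set K is the part of C read by w, and the rest is read by
    v. *)
Lemma wedge_merges n (v w : ext S n) (C : {set 'I_n}) :
  wedge v w C = merges (direct_sum v w) (enum 'I_n) (inl @: C).
Proof.
have inlr (K : {set 'I_n}) x : (inr x \in [set (inl y : 'I_n + 'I_n) | y in
  K]%SET) = false.
  by apply/negbTE/imsetP => -[].
have inrl (K : {set 'I_n}) x : (inl x \in [set (inr y : 'I_n + 'I_n) | y in
  K]%SET) = false.
  by apply/negbTE/imsetP => -[].
rewrite wedgeE mergesE ?enum_uniq //; last by move=> k _; rewrite inlr.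
have -> : [set k in enum 'I_n | inl k \in [set (inl y : 'I_n + 'I_n) | y in
  C]]%SET = C.
  by apply/setP => x; rewrite !inE mem_enum inE (finset.mem_imset _ _ inl_inj).
apply: eq_bigr => K _; congr (v _ * w _); apply/setP => x; rewrite !inE.
  by rewrite !(finset.mem_imset _ _ inl_inj) inrl orbF.
by rewrite !inlr (finset.mem_imset _ _ inr_inj) andbF.
Qed.

Lemma wedge_exchange n (v w : ext S n) :
  exchange v -> exchange w -> exchange (wedge v w).
Proof.
move=> v_exch w_exch A B j jA jB; pose inL := @inl 'I_n 'I_n.
have inLD (C : {set 'I_n}) i : inL @: (C :\ i) = inL @: C :\ inL i.
  apply/setP => x; rewrite !inE; apply/imsetP/andP.
    by case=> y; rewrite !inE => /andP[yi yC ->];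
      rewrite (inj_eq inl_inj) imset_f.
  by case=> xi /imsetP[y yC ex]; exists y; rewrite // !inE yC andbT;
    apply: contraNneq xi; rewrite ex => ->.
have inLU (C : {set 'I_n}) i : inL @: (i |: C) = inL i |: inL @: C.
  by rewrite imsetU1.
rewrite !wedge_merges -/inL inLD inLU.
have jA' : inL j \in inL @: A by apply: imset_f.
have jB' : inL j \notin inL @: B by rewrite (finset.mem_imset _ _ inl_inj).
have M := merges_exchange (enum 'I_n) (direct_sum_exchange v_exch w_exch).
apply: sle_trans (M _ _ _ jA' jB') _.
apply: sle_sum2 => // x /and3P[/imsetP[i iA ->]].
rewrite (finset.mem_imset _ _ inl_inj) (inj_eq inl_inj) => iB ij.
exists i; first by rewrite iA iB.
by rewrite !wedge_merges -/inL inLD inLU; apply: sle_refl.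
Qed.

End Exchange.

(** * Tropical linear spaces *)

Section TropicalLinearSpaces.
Variables (S : comNzSemiRingType) (hS : idempotent_semifield S) (n : nat).
Implicit Types (v w : ext S n) (p : 'cV[S]_n) (A B I J : {set 'I_n}).

(** For v homogeneous of degree d and [#|B| = d - 1], a valuated cocircuit or 0: the entries on B
    vanish because [i |: B = B] is too small. *)
Definition cocircuit v B : 'cV[S]_n := \col_i v (i |: B).

Lemma setU1_mem (T : finType) (x : T) (X : {set T}) : x \in X -> x |: X = X.
Proof.
by move=> xX; apply/setP => y; rewrite !inE; have [->|] := eqVneq y x;
  rewrite ?xX.
Qed.

Lemma homog_card d v I : homog d v -> v I != 0 -> #|I| = d.
Proof. by move=> hv; apply: contra_neq_eq => /hv. Qed.

Lemma ext_neq0 v : v != 0 -> exists I, v I != 0.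
Proof.
move=> v0; have [I vI|no] := pickP (fun I => v I != 0); first by exists I.
by case/eqP: v0; apply/ffunP => I; rewrite ffunE; have /negbFE/eqP := no I.
Qed.

Lemma setD1_eq_card I J : #|I| = #|J| -> I != J -> exists2 i, i \in I & i
  \notin J.
Proof.
move=> cIJ;
  have [/fintype.subsetP sIJ|/fintype.subsetPn[i iI iJ] _] := boolP (I \subset
    J).
  by move/negP; case; rewrite eqEcard cIJ leqnn andbT; apply/fintype.subsetP.
by exists i.
Qed.

(** At any other cardinalities the product at j contains a coordinate of the wrong degree, which is
    0. *)
Lemma is_pluckerE d v :
  is_plucker d v <-> [/\ v != 0, homog d v & exchange v].
Proof.
split=> -[v0 hv rel]; split=> // A B j.
  move=> jA jB.
  have [->|/(homog_card hv) cA] := eqVneq (v (A :\ j)) 0.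
    by rewrite mul0r; apply: sle0.
  have [->|/(homog_card hv) cB] := eqVneq (v (j |: B)) 0.
    by rewrite mulr0; apply: sle0.
  have jAB : j \in A :\: B by rewrite inE jB.
  have := rel A B j;
    rewrite (cardsD1 j A) jA cA -cB cardsU1 jB => /(_ erefl erefl jAB).
  rewrite (big_setD1 j) //= /sle => E.
  rewrite (eq_bigl (fun i => i \in (A :\: B) :\ j)) // => i.
  by rewrite !inE; case: (i \in A); case: (i \in B); rewrite ?andbT ?andbF.
move=> _ _; rewrite inE => /andP[jB jA].
rewrite [LHS](big_setD1 j) ?inE ?jA ?jB //=; have := rel A B j jA jB;
  rewrite /sle.
rewrite (eq_bigl (fun i => i \in (A :\: B) :\ j)) // => i.
by rewrite !inE; case: (i \in A); case: (i \in B); rewrite ?andbT ?andbF.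
Qed.

Lemma tlsP d v p : homog d v ->
  tls d v p <-> forall A j, j \in A ->
    v (A :\ j) * p j 0 <<= \sum_(i | (i \in A) && (i != j)) v (A :\ i) * p i 0.
Proof.
move=> hv; split=> [Tp A j jA|H A cA].
  have [->|vA] := eqVneq (v (A :\ j)) 0; first by rewrite mul0r; apply: sle0.
  have cA : #|A| = d.+1 by rewrite (cardsD1 j) jA (homog_card hv vA).
  have /vanishingE/(_ j) := Tp A cA; rewrite mxE jA => le.
  apply: sle_trans le _; apply: sle_sum => i ij; rewrite mxE.
  case: ifP => iA; last by rewrite mul0r; apply: sle0.
  by apply: (sle_bigl hS (i := i)); [rewrite iA|apply: sle_refl].
apply/vanishingE => j; rewrite mxE; case: ifP => jA; last first.
  by rewrite mul0r; apply: sle0.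
apply: sle_trans (H A j jA) _; apply: sle_sum2 => // i /andP[iA ij].
by exists i; rewrite // mxE iA; apply: sle_refl.
Qed.

Lemma tls_submodule d v : is_submodule (tls d v).
Proof.
have H A := hyperplane_submodule (plucker_form v A).
split=> [A _|p q Tp Tq A cA|c p Tp A cA]; have [H0 HD HZ] := H A => //.
  by apply: HD; [apply: Tp|apply: Tq].
by apply: HZ; apply: Tp.
Qed.

Lemma cocircuit_tls d v B :
  homog d v -> exchange v -> #|B|.+1 = d -> tls d v (cocircuit v B).
Proof.
move=> hv xv cB; apply/(tlsP _ hv) => A j jA; rewrite mxE.
have [jB|jB] := boolP (j \in B).
  rewrite setU1_mem // (hv B) ?mulr0; first exact: sle0.
  by rewrite -cB neq_ltn ltnSn.
apply: sle_trans (xv A B j jA jB) _; apply: sle_sum2 => // i /and3P[iA iB ij].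
by exists i; rewrite ?iA // mxE; apply: sle_refl.
Qed.

(** The matroid fact that a cocircuit meets every basis: if p vanished on J, the relation for
    [k |: J] would have its single nonzero term at k. *)
Lemma tls_meets_basis d w p J k : homog d w -> tls d w p -> w J != 0 ->
  p k 0 != 0 -> exists2 j, j \in J & p j 0 != 0.
Proof.
move=> hw /(tlsP _ hw) Tp wJ pk; have [kJ|kJ] := boolP (k \in J);
  first by exists k.
have := Tp (k |: J) k (setU11 _ _); rewrite finset.setU1K // => le.
have /(neq0_sum)[j]: \sum_(i | (i \in k |: J) && (i != k)) w ((k |: J) :\ i) *
  p i 0 != 0.
  by apply: contraNneq (muls_neq0 hS wJ pk) => E; rewrite E in le;
    rewrite (sle_eq0 le).
rewrite !inE => /andP[/orP[->//|jJ] _] wp; exists j => //.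
by apply: contraNneq wp => ->; rewrite mulr0.
Qed.

(** On [cocircuit v B] the relation of w for [i |: (j |: B)] keeps only its terms at i and j, as the
    entries on B vanish; each of the two is then bounded by the other. *)
Lemma cocircuit_ratio d v w B i j : homog d v -> homog d w ->
  tls d w (cocircuit v B) -> #|B|.+1 = d -> i \notin B -> j \notin B ->
  w (j |: B) * v (i |: B) = w (i |: B) * v (j |: B).
Proof.
move=> hv hw /(tlsP _ hw) T cB.
have half k l : k \notin B -> l \notin B -> k != l ->
    w (l |: B) * v (k |: B) <<= w (k |: B) * v (l |: B).
  move=> kB lB kl.
  have E a b : a \notin B -> a != b -> (a |: (b |: B)) :\ a = b |: B.
    by move=> aB ab; rewrite finset.setU1K // !inE negb_or ab.
  have := T (k |: (l |: B)) k (setU11 _ _); rewrite E // mxE => le.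
  apply: sle_trans le _; apply: sle_sum => m; rewrite !inE mxE.
  case/andP=> /or3P[/eqP->|/eqP-> _|mB _]; first by rewrite eqxx.
    by rewrite finset.setUCA E // 1?eq_sym //; apply: sle_refl.
  rewrite (setU1_mem mB) (hv B) ?mulr0; first exact: sle0.
  by rewrite -cB neq_ltn ltnSn.
move=> iB jB; have [->//|ij] := eqVneq i j.
by apply: (sle_anti); apply: half; rewrite // eq_sym.
Qed.

(** Take I in the support of v and J in that of w with the largest intersection. If they differed,
    some i in I outside J could be traded for a j in J, since [cocircuit v (I :\ i)] is nonzero
    somewhere on J, and the intersection would grow. *)
Lemma common_basis d v w : v != 0 -> w != 0 -> homog d v -> homog d w ->
  (forall B, #|B|.+1 = d -> tls d w (cocircuit v B)) ->
  exists2 I, v I != 0 & w I != 0.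
Proof.
move=> /ext_neq0[I0 vI0] /ext_neq0[J0 wJ0] hv hw T.
have P0 : (v (I0, J0).1 != 0) && (w (I0, J0).2 != 0) by rewrite vI0.
case: (@arg_maxnP _ (I0, J0) (fun x => (v x.1 != 0) && (w x.2 != 0))
                    (fun x => #|x.1 :&: x.2|) P0).
case=> I J /= /andP[vI wJ] maxIJ; have cI := homog_card hv vI.
have [eIJ|nIJ] := eqVneq I J; first by exists I; rewrite // eIJ.
have [|i iI iJ] := setD1_eq_card _ nIJ; first by rewrite cI (homog_card hw wJ).
have cB : #|I :\ i|.+1 = d by rewrite -cI (cardsD1 i I) iI.
have [|j jJ] := tls_meets_basis hw (T _ cB) wJ (k := i).
  by rewrite mxE finset.setD1K.
rewrite mxE => vj.
have jB : j \notin I :\ i.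
  apply: contraNN vj => jB; apply/eqP/hv.
  by rewrite setU1_mem // -cB neq_ltn ltnSn.
have := maxIJ (j |: I :\ i, J); rewrite /= vj wJ => /(_ isT).
have -> : (j |: I :\ i) :&: J = j |: (I :&: J).
  apply/setP => x; rewrite !inE; have [->|] /= := eqVneq x j;
    first by rewrite jJ.
  by have [->|] := eqVneq x i; rewrite //= (negbTE iJ) andbF.
have nj : j \notin I :&: J.
  rewrite !inE jJ andbT; apply: contra jB => jI; rewrite !inE jI andbT.
  by apply: contraNneq iJ => <-.
by rewrite cardsU1 nj ltnn.
Qed.

(** Induction on the number of elements of J outside I: one of them is traded for an element of I
    within the support of v, and [cocircuit_ratio] shows that the trade preserves the ratio of w to
    v. *)
Lemma basis_ratio d v w I : is_plucker d v -> homog d w ->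
  (forall B, #|B|.+1 = d -> tls d w (cocircuit v B)) -> v I != 0 ->
  forall J, v J != 0 -> w J * v I = v J * w I.
Proof.
move=> /is_pluckerE[_ hv xv] hw T vI J.
have [k] := ubnP #|J :\: I|; elim: k J => // k IHk J ltk vJ.
have cJ := homog_card hv vJ.
have [->|nJI] := eqVneq J I; first by rewrite mulrC.
have [|j jJ jI] := setD1_eq_card _ nJI; first by rewrite cJ (homog_card hv vI).
have cB : #|J :\ j|.+1 = d by rewrite -cJ (cardsD1 j J) jJ.
have [|i iI] := tls_meets_basis hv (cocircuit_tls hv xv cB) vI (k := j).
  by rewrite mxE finset.setD1K.
rewrite mxE => vi.
have iB : i \notin J :\ j.
  apply: contraNN vi => iB; apply/eqP/hv.
  by rewrite setU1_mem // -cB neq_ltn ltnSn.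
have jB : j \notin J :\ j by rewrite !inE eqxx.
have := cocircuit_ratio hv hw (T _ cB) cB iB jB.
rewrite finset.setD1K // => E.
have := IHk (i |: J :\ j) _ vi; have -> : (i |: J :\ j) :\: I = (J :\: I) :\ j.
  apply/setP => x; rewrite !inE; have [->|] /= := eqVneq x i;
    first by rewrite iI andbF.
  by case: (x \in I) => //=; rewrite andbF.
have ltk' : (#|(J :\: I) :\ j| < k)%N.
  by move: ltk; rewrite (cardsD1 j (J :\: I)) !inE jI jJ ltnS.
move=> /(_ ltk') IH; apply: (mulsI hS vi).
by rewrite mulrCA mulrA E mulrAC IH -mulrA [w I * _]mulrC.
Qed.

(** Equality in projective space, with a scalar on each side to keep it symmetric and free of
    inverses. *)
Definition proportional v w : Prop :=
  exists a b, [/\ a != 0, b != 0 & forall I, a * v I = b * w I].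

Lemma tls_inj d v w : is_plucker d v -> is_plucker d w ->
  tls d v = tls d w -> proportional v w.
Proof.
move=> pv pw Tvw; have [v0 hv xv] := (is_pluckerE _ _).1 pv.
have [w0 hw xw] := (is_pluckerE _ _).1 pw.
have Tv B : #|B|.+1 = d -> tls d w (cocircuit v B).
  by rewrite -Tvw; apply: cocircuit_tls.
have Tw B : #|B|.+1 = d -> tls d v (cocircuit w B).
  by rewrite Tvw; apply: cocircuit_tls.
have [I vI wI] := common_basis v0 w0 hv hw Tv.
have Rv := basis_ratio pv hw Tv vI; have Rw := basis_ratio pw hv Tw wI.
exists (w I), (v I); split=> // J.
(* [Rv] covers only the support of v; where v vanishes, [Rw] takes over on the support of w. *)
have [vJ|/Rv E] := eqVneq (v J) 0; last by rewrite mulrC -E mulrC.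
have [->|wJ] := eqVneq (w J) 0; first by rewrite vJ !mulr0.
by rewrite mulrC (Rw _ wJ) mulrC.
Qed.

Lemma tls_proportional d v w : proportional v w -> tls d v = tls d w.
Proof.
case=> a [b [a0 b0 E]]; apply/seteqP; split=> p Tp A cA;
  have /vanishingE := Tp A cA => H; apply/vanishingE.
- apply: (vanishing_scaleI hS b0);
    apply: eq_vanishing (vanishing_scale a H) => i.
  by rewrite !mxE !mulrA; case: ifP => _; rewrite ?mulr0 // E.
- apply: (vanishing_scaleI hS a0);
    apply: eq_vanishing (vanishing_scale b H) => i.
  by rewrite !mxE !mulrA; case: ifP => _; rewrite ?mulr0 // E.
Qed.

End TropicalLinearSpaces.

(** * Spanning by cocircuits, and duality *)

Section Duality.
Variables (S : comNzSemiRingType) (hS : idempotent_semifield S) (n : nat).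
Implicit Types (v w : ext S n) (a p : 'cV[S]_n) (A B I J : {set 'I_n}).

(* Let P be the support of p, and F the set of bases I with #|I :&: P| minimal,
   weighted by W I := v I * \prod_(i in P :\: I) p i.  For j in P, the relations
   satisfied by p show that the bases of F containing j already have total
   weight tot := \sum_(I in F) W I.  Hence p is the sum of the vectors
   (W I * p j / (tot * v I)) * cocircuit v (I :\ j), for j in I and I in F: each
   of them is at most p by the exchange of one element of I, and those with
   a given j add up to p j in coordinate j. *)
Lemma tls_span d v p (M : set 'cV[S]_n) : v != 0 -> homog d v -> tls d v p ->
  is_submodule M -> (forall B, #|B|.+1 = d -> M (cocircuit v B)) -> M p.
Proof.
move=> /(ext_neq0) [I0 vI0] hv /(tlsP hS _ hv) Tp subM Mcoc.
pose P := [set i | p i 0 != 0]%SET.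
case: (@arg_minnP _ I0 (fun I => v I != 0) (fun I => #|I :&: P|) vI0) => J0 vJ0.
set m := #|J0 :&: P| => min_m.
pose F I := (v I != 0) && (#|I :&: P| == m).
pose C I := \prod_(i in P :\: I) p i 0.
pose W I := v I * C I.
have inP i : (i \in P) = (p i 0 != 0) by rewrite inE.
have C_add I i : i \in P -> i \notin I -> C I = p i 0 * C (i |: I).
  move=> iP iI; rewrite /C (big_setD1 i) ?inE ?iI -?inP //; congr (_ * _).
  by apply: eq_bigl => x; rewrite !inE negb_or andbA.
have W_neq0 I : F I -> W I != 0.
  case/andP=> vI _; apply: muls_neq0 => //; apply: sprod_neq0 => // i.
  by rewrite !inE => /andP[].
pose tot := \sum_(I | F I) W I.
have F0 : F J0 by rewrite /F vJ0 eqxx.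
have tot_neq0 : tot != 0.
  by apply: contraNneq (W_neq0 _ F0) => E; rewrite (psum_eq0 hS E F0).
have W_le I : F I -> W I <<= tot by move=> FI;
  apply: (sle_bigl hS FI (sle_refl _ _)).
have F_swap I i j : F I -> i \notin I -> j \in I -> v (i |: I :\ j) != 0 ->
    p i 0 != 0 -> p j 0 != 0 -> F (i |: I :\ j).
  case/andP=> vI /eqP cI iI jI vK pi pj; rewrite /F vK -cI /=.
  have -> : (i |: I :\ j) :&: P = i |: (I :&: P) :\ j.
    by apply/setP => x; rewrite !inE; have [->|] /= := eqVneq x i;
      rewrite ?pi // andbA.
  rewrite cardsU1 !inE (negbTE iI) !andbF /= (cardsD1 j (I :&: P)) !inE jI.
  by rewrite pj.
have tot_at j : j \in P -> tot = \sum_(I | F I && (j \in I)) W I.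
  move=> jP; have pj : p j 0 != 0 by rewrite -inP.
  apply: (sle_anti); last first.
    by apply: sle_sum => I /andP[FI _]; apply: W_le.
  apply: sle_sum => I FI; have [jI|jI] := boolP (j \in I).
    by apply: (sle_bigl hS (i := I)); [rewrite FI|apply: sle_refl].
  rewrite /W (C_add I j) // mulrA.
  (* The relation at [j |: I] replaces [v I * p j 0] by terms trading some i of I for j; if [p i 0]
     is nonzero, the trade keeps the size of the intersection with P. *)
  have := Tp (j |: I) j (setU11 _ _); rewrite finset.setU1K // => le.
  apply: sle_trans (sleM2r _ le) _; rewrite mulr_suml; apply: sle_sum => i.
  rewrite !inE => /andP[/orP[/eqP->|iI] nij]; first by rewrite eqxx in nij.
  have [->|pi] := eqVneq (p i 0) 0; first by rewrite mulr0 mul0r; apply: sle0.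
  have EK : (j |: I) :\ i = j |: I :\ i.
    by apply/setP => x; rewrite !inE; have [->|] := eqVneq x j;
      rewrite // eq_sym nij.
  rewrite EK.
  have [->|vK] := eqVneq (v (j |: I :\ i)) 0; first by rewrite !mul0r;
    apply: sle0.
  apply: (sle_bigl hS (i := j |: I :\ i)); first by rewrite F_swap // setU11.
  rewrite /W (C_add (j |: I :\ i) i) ?inP //;
    last by rewrite !inE eqxx (negbTE nij).
  rewrite finset.setUCA finset.setD1K // mulrA; exact: sle_refl.
pose c I j := W I * p j 0 * sinv (tot * v I).
pose q := \sum_(j in P) \sum_(I | F I && (j \in I)) c I j *: cocircuit v (I :\
  j).
suff -> : p = q.
  apply: submodule_sum => // j jP;
    apply: submodule_sum => // I /andP[/andP[vI _] jI].
  case: subM => _ _; apply; apply: Mcoc.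
  by rewrite -(homog_card hv vI) (cardsD1 j I) jI.
have cE I j : F I -> c I j * v I = W I * p j 0 * sinv tot.
  by case/andP=> vI _; rewrite /c -[LHS]mulrA sinvMr.
apply/matrixP => i k; rewrite ord1 {k} summxE.
under eq_bigr => j _ do rewrite summxE.
apply: (sle_anti).
  have [->|pi] := eqVneq (p i 0) 0; first exact: sle0.
  apply: (sle_bigl hS (i := i)); first by rewrite inP.
  have -> : p i 0 = \sum_(I | F I && (i \in I)) W I * p i 0 * sinv tot.
    by rewrite -!mulr_suml -tot_at ?inP // mulrAC mulVs // mul1r.
  apply: sle_sum2 => // I /andP[FI iI]; exists I; first by rewrite FI.
  by rewrite !mxE finset.setD1K // cE //; apply: sle_refl.
apply: sle_sum => j jP; apply: sle_sum => I /andP[FI jI]; rewrite !mxE.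
have [/andP[vI _] pj] := (FI, jP); rewrite inP in pj.
have [->|vK] := eqVneq (v (i |: I :\ j)) 0; first by rewrite mulr0; apply: sle0.
have [eij|nij] := eqVneq i j.
  rewrite eij finset.setD1K // cE
    // mulrAC -[X in _ <<= X]mul1r -(mulVs hS tot_neq0).
  by apply: sleM2r; apply: sleM2r; apply: W_le.
have iI : i \notin I.
  apply: contraNN vK => iI; apply/eqP/hv; rewrite setU1_mem ?inE ?nij //.
  by rewrite -(homog_card hv vI) (cardsD1 j I) jI neq_ltn ltnSn.
have cK : #|(i |: I :\ j) :&: P| = addn (p i 0 != 0) #|(I :&: P) :\ j|.
  have [pi|pi] := eqVneq (p i 0) 0.
    congr #|pred_of_set _|; apply/setP => x; rewrite !inE.
    by have [->|] /= := eqVneq x i; rewrite ?pi ?eqxx ?andbF // andbA.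
  have -> : (i |: I :\ j) :&: P = i |: (I :&: P) :\ j.
    by apply/setP => x; rewrite !inE; have [->|] /= := eqVneq x i;
      rewrite ?pi // andbA.
  by rewrite cardsU1 !inE (negbTE iI) !andbF.
(* Otherwise trading j for i would give a basis meeting P in fewer than m elements. *)
have pi : p i 0 != 0.
  apply: contraT => /negPn/eqP pi; have := min_m _ vK.
  rewrite cK pi eqxx /= add0n; case/andP: FI => _ /eqP <-.
  by rewrite (cardsD1 j (I :&: P)) !inE jI pj ltnn.
have FK := F_swap I i j FI iI jI vK pi pj.
(* Both sides equal [v I * v (i |: I :\ j) * p i 0 * p j 0] times the product of p over P outside
   [i |: I]. *)
have swap : W I * (p j 0 * v (i |: I :\ j)) = v I * p i 0 * W (i |: I :\ j).
  rewrite /W (C_add I i) ?inP // (C_add (i |: I :\ j) j) ?inP //; last first.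
    by rewrite !inE eqxx eq_sym (negbTE nij).
  rewrite finset.setUCA finset.setD1K //.
  by rewrite -!mulrA; congr (_ * (_ * _)); rewrite mulrC -mulrA mulrCA.
have -> : c I j * v (i |: I :\ j) = p i 0 * (W (i |: I :\ j) * sinv tot).
  rewrite /c mulrAC -[W I * _ * _]mulrA swap -(sinvMr hS tot_neq0 vI).
  by rewrite -!mulrA mulrC -!mulrA.
rewrite -[X in _ <<= X]mulr1 -(mulVs hS tot_neq0).
by apply: sleM2l; apply: sleM2r; apply: W_le.
Qed.

Lemma homog_le d v : v != 0 -> homog d v -> (d <= n)%N.
Proof.
move=> /(ext_neq0) [I vI] hv; rewrite -(homog_card hv vI).
by rewrite -[leqRHS]card_ord; apply: max_card.
Qed.

Lemma starK v : star (star v) = v.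
Proof. by apply/ffunP => I; rewrite !ffunE finset.setCK. Qed.

Lemma star_homog d v : (d <= n)%N -> homog d v -> homog (n - d) (star v).
Proof.
move=> led hv I cI; rewrite ffunE; apply: hv; apply: contra_neq cI => cI.
by have := cardsC I; rewrite card_ord cI => En; apply/esym/eqP;
  rewrite -[X in (X - d)%N]En addnK.
Qed.

(** Complementation turns removal into insertion, so A and B swap roles. *)
Lemma star_exchange v : exchange v -> exchange (star v).
Proof.
have CD A i : ~: (A :\ i) = i |: ~: A.
  by apply/setP => x; rewrite !inE negb_and negbK.
have CU A i : ~: (i |: A) = ~: A :\ i.
  by apply/setP => x; rewrite !inE negb_or.
move=> xv A B j jA jB; rewrite !ffunE CD CU mulrC.
have jB' : j \in ~: B by rewrite inE.
have jA' : j \notin ~: A by rewrite inE negbK.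
apply: sle_trans (xv _ _ _ jB' jA') _; apply: sle_sum2 => // i.
rewrite !inE negbK => /and3P[iB iA ij]; exists i; first by rewrite iA iB.
by rewrite !ffunE CD CU mulrC; apply: sle_refl.
Qed.

Lemma star_plucker d v : is_plucker d v -> is_plucker (n - d) (star v).
Proof.
case/is_pluckerE=> v0 hv xv; apply/is_pluckerE; split.
- by apply: contra_neq v0 => E; rewrite -[v]starK E; apply/ffunP => I;
    rewrite !ffunE.
- exact/star_homog/hv/homog_le/hv.
- exact: star_exchange.
Qed.

(** The forms defining the space of [star v] are the cocircuits of v at complementary sets. If a is
    orthogonal to all of them, its hyperplane contains their span, which is all of T_v by
    [tls_span]. *)
Lemma orthogonal_dual_tls d v :
  is_plucker d v -> orthogonal_dual (tls d v) = tls (n - d) (star v).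
Proof.
case/is_pluckerE=> v0 hv xv; have led := homog_le v0 hv.
have cC A : #|A| = (n - d).+1 -> #|~: A|.+1 = d.
  move=> cA; have := cardsC A; rewrite card_ord cA => E.
  by apply: (@addnI (n - d)%N); rewrite subnK // addnS -addSn.
have formE A : #|A| = (n - d).+1 -> plucker_form (star v) A =
  cocircuit v (~: A).
  move=> cA; apply/matrixP => i k; rewrite ord1 !mxE; case: ifP => iA.
    by rewrite ffunE; congr (v _); apply/setP => x; rewrite !inE negb_and negbK.
  rewrite setU1_mem ?inE ?iA // hv //.
  by rewrite -(cC _ cA) neq_ltn ltnSn.
apply/seteqP; split=> a Ta.
  move=> A cA; rewrite formE //; apply: Ta; apply: cocircuit_tls => //.
  exact: cC.
move=> p Tp; suff : hyperplane a p.
  move=> /vanishingE H; apply/vanishingE; apply: eq_vanishing H => i.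
  exact: mulrC.
apply: (tls_span v0 hv Tp (hyperplane_submodule a)) => B cB.
have cA : #|~: B| = (n - d).+1.
  by have := cardsC B;
    rewrite card_ord -[in RHS](subnK led) -cB addnS -addSn addnC => /addIn.
have /vanishingE H := Ta _ cA; apply/vanishingE; apply: eq_vanishing H => i.
by rewrite formE // finset.setCK mulrC.
Qed.

End Duality.

(** * Monomial matrices *)

Section Monomial.
Variables (S : comNzSemiRingType) (hS : idempotent_semifield S) (n : nat).
Implicit Types (v w : ext S n) (p : 'cV[S]_n) (s t : 'S_n) (l m : 'I_n -> S).
Implicit Types (A B : 'M[S]_n) (I J X : {set 'I_n}).

(** Stated over any commutative semiring: the same predicate serves matrices over the semifield and
    over the field k. *)
Definition monomial_with A s l : Prop :=
  (forall i, l i != 0) /\ forall i j, A j i = l i * (j == s i)%:R.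

(** A sum in S is 0 only if all its terms are. Choosing [f i] with [A i (f i) * B (f i) i] nonzero,
    the zero of [A *m B] at (j, i) forces [A j (f i) = 0]: column [f i] is supported on row i alone,
    so f is injective. *)
Lemma invertible_monomial A B : A *m B = 1%:M -> exists s l, monomial_with A s
  l.
Proof.
move=> AB1; have AB i j : \sum_k A i k * B k j = (i == j)%:R.
  by have := congr1 (fun M : 'M_n => M i j) AB1; rewrite !mxE.
have ex i : exists k, A i k * B k i != 0.
  have [|k _ ABk] := neq0_sum (P := xpredT) (F := fun k => A i k * B k i).
    by rewrite AB eqxx oner_neq0.
  by exists k.
pose f i := xchoose (ex i).
have fP i : (A i (f i) != 0) && (B (f i) i != 0).
  rewrite -negb_or; apply: contra (xchooseP (ex i)) => /orP[] /eqP E.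
    by rewrite -/(f i) E mul0r.
  by rewrite -/(f i) E mulr0.
have A0 i j : j != i -> A j (f i) = 0.
  move=> ji; have := AB j i;
    rewrite (negbTE ji) => /(psum_eq0 hS (i := f i))/(_ isT) E.
  by apply: contraTeq isT => Aj; have /andP[_ /(muls_neq0 hS Aj)] := fP i;
    rewrite E eqxx.
have f_inj : injective f.
  move=> i j E; apply/eqP; apply: contraT => ij.
  by have /andP[] := fP i; rewrite E A0 ?eqxx.
pose s := perm f_inj.
exists s^-1%g, (fun k => A (s^-1%g k) k); split=> [k|k j].
  by have /andP[] := fP (s^-1%g k); rewrite -(permE f_inj) permKV.
have [->|jk] := eqVneq j (s^-1%g k); first by rewrite mulr1.
by rewrite mulr0 -[in LHS](permKV s k) (permE f_inj) A0.
Qed.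

(** The action of a monomial matrix in coordinates: e_I goes to a multiple of e_(s @: I), so the
    coordinate at X is read at the preimage of X. *)
Definition twist s l v : ext S n :=
  [ffun X : {set 'I_n} => (\prod_(i in s @^-1: X) l i) * v (s @^-1: X)].

Lemma preim_permE s I : s @^-1: (s @: I) = I.
Proof. by apply/setP => i; rewrite inE (finset.mem_imset _ _ perm_inj). Qed.

Lemma imset_preimE s X : s @: (s @^-1: X) = X.
Proof.
apply/setP => i; rewrite -{1}(permKV s i) (finset.mem_imset _ _ perm_inj) inE.
by rewrite permKV.
Qed.

Lemma ext_map_twist A s l v : monomial_with A s l -> ext_map A v = twist s l v.
Proof.
case=> l0 AE; have colA i : col i A = l i *: delta_mx (s i) 0.
  by apply/matrixP => j k; rewrite !mxE AE ord1 eqxx andbT.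
have basisE I X : (\big[@wedge S n/ext_basis S finset.set0]_(i in I) ext_vec
  (col i A)) X =
    (\prod_(i in I) l i) * (X == s @: I)%:R.
  have := congr1 (fun u : ext S n => u X) (ext_map_monomial I colA).
  rewrite !ffunE (bigD1 I) //= big1 ?addr0 => [|K /negbTE KI]; last first.
    by rewrite ffunE KI mul0r.
  by rewrite ffunE eqxx mul1r.
apply/ffunP => X; rewrite !ffunE (bigD1 (s @^-1: X)) //= big1 ?addr0 => [|K KX].
  by rewrite basisE imset_preimE eqxx mulr1 mulrC.
rewrite basisE; case: eqP => [E|_]; last by rewrite !mulr0.
by rewrite E preim_permE eqxx in KX.
Qed.

Lemma twist1 v : twist 1%g (fun=> 1) v = v.
Proof.
apply/ffunP => X; rewrite ffunE big1 // mul1r; congr (v _).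
by apply/setP => i; rewrite inE perm1.
Qed.

Lemma twist_comp s t l m v :
  twist s l (twist t m v) = twist (t * s)%g (fun i => m i * l (t i)) v.
Proof.
apply/ffunP => X; rewrite !ffunE mulrA; congr (_ * v _); last first.
  by apply/setP => i; rewrite !inE permM.
rewrite big_split /= mulrC; congr (_ * _).
  by apply: eq_bigl => i; rewrite !inE permM.
rewrite (reindex_inj (@perm_inj _ t)) /=.
by apply: eq_bigl => i; rewrite !inE permM.
Qed.

Lemma monomial1 : monomial_with 1%:M 1%g (fun=> 1).
Proof.
by split=> [i|i j]; rewrite ?oner_neq0 // mxE perm1 mul1r.
Qed.

Lemma monomialM A B s t l m : monomial_with A s l -> monomial_with B t m ->
  monomial_with (A *m B) (t * s)%g (fun i => m i * l (t i)).
Proof.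
case=> l0 AE [m0 BE]; split=> [i|i j]; first exact: muls_neq0.
rewrite mxE (bigD1 (t i)) //= big1 ?addr0 => [|k /negbTE ki].
  by rewrite AE BE eqxx mulr1 permM mulrAC [l _ * _]mulrC.
by rewrite BE ki !mulr0.
Qed.

Lemma twist_homog d s l v : homog d v -> homog d (twist s l v).
Proof.
move=> hv X cX; rewrite ffunE hv ?mulr0 //; apply: contra_neq cX => <-.
by rewrite -[in LHS](imset_preimE s X) card_imset //; apply: perm_inj.
Qed.

Lemma twist_exchange s l v : exchange v -> exchange (twist s l v).
Proof.
move=> xv X Y j jX jY; rewrite !ffunE.
(* Moving [s i] from X to Y moves the weight [l i] from one product to the other, so all terms of
   the relation carry the same factor c. *)
pose c := (\prod_(i in s @^-1: X) l i) * (\prod_(i in s @^-1: Y) l i).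
have D Z i : s @^-1: (Z :\ s i) = (s @^-1: Z) :\ i.
  by apply/setP => k; rewrite !inE (inj_eq perm_inj).
have U Z i : s @^-1: (s i |: Z) = i |: s @^-1: Z.
  by apply/setP => k; rewrite !inE (inj_eq perm_inj).
have term i : s i \in X -> s i \notin Y ->
    twist s l v (X :\ s i) * twist s l v (s i |: Y) =
    c * (v ((s @^-1: X) :\ i) * v (i |: s @^-1: Y)).
  move=> iX iY; rewrite !ffunE mulrACA D U; congr (_ * _).
  rewrite big_setU1 ?inE //= mulrA [_ * l i]mulrC; congr (_ * _).
  by rewrite [RHS](big_setD1 i) ?inE.
have := term (s^-1%g j); rewrite permKV !ffunE => /(_ jX jY) ->.
have jX' : s^-1%g j \in s @^-1: X by rewrite inE permKV.
have jY' : s^-1%g j \notin s @^-1: Y by rewrite inE permKV.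
apply: sle_trans (sleM2l c (xv _ _ _ jX' jY')) _; rewrite mulr_sumr.
apply: sle_sum2 => // i; rewrite !inE => /and3P[iX iY ij]; exists (s i).
  by rewrite iX iY (can2_eq (permK s) (permKV s)).
by rewrite term //; apply: sle_refl.
Qed.

Lemma twist_plucker d s l v : (forall i, l i != 0) ->
  is_plucker d v -> is_plucker d (twist s l v).
Proof.
move=> l0 /is_pluckerE[/ext_neq0[I vI] hv xv]; apply/is_pluckerE; split.
- apply: contraTneq isT => E.
  have := congr1 (fun u : ext S n => u (s @: I)) E.
  rewrite !ffunE preim_permE => /eqP; apply: contraLR => _.
  by apply: muls_neq0 => //; apply: sprod_neq0.
- exact: twist_homog.
- exact: twist_exchange.
Qed.

Lemma monomial_mulmx q A s l (M : 'M[S]_(n, q)) i j : monomial_with A s l ->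
  (A *m M) (s i) j = l i * M i j.
Proof.
case=> _ AE; rewrite mxE (bigD1 i) //= big1 ?addr0 => [|k /negbTE ki].
  by rewrite AE eqxx mulr1.
by rewrite AE (inj_eq perm_inj) eq_sym ki mulr0 mul0r.
Qed.

Lemma monomial_surj A s l p : monomial_with A s l -> exists q, p = A *m q.
Proof.
move=> mA; have [l0 _] := mA; exists (\col_i (sinv (l i) * p (s i) 0)).
apply/matrixP => i k; rewrite ord1 -(permKV s i) (monomial_mulmx _ _ _ mA) mxE.
by rewrite mulrA mulVs // mul1r.
Qed.

(** The weight [l i] missing from the coordinate at [X :\ i] is supplied by the entry of [A *m p] at
    [s i], so each form changes only by a permutation of its terms and a common nonzero factor. *)
Lemma tls_twist d A s l v p : monomial_with A s l ->
  tls d (twist s l v) (A *m p) <-> tls d v p.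
Proof.
move=> mA; have [l0 _] := mA.
have E X i : plucker_form (twist s l v) (s @: X) (s i) 0 * (A *m p) (s i) 0 =
    (\prod_(k in X) l k) * (plucker_form v X i 0 * p i 0).
  rewrite (monomial_mulmx _ _ _ mA) !mxE (finset.mem_imset _ _ perm_inj).
  case: ifP => iX; last by rewrite !mul0r mulr0.
  have -> : s @: X :\ s i = s @: (X :\ i).
    apply/setP => j; rewrite -(permKV s j) !inE (inj_eq perm_inj).
    by rewrite !(finset.mem_imset _ _ perm_inj) !inE.
  by rewrite ffunE preim_permE [in RHS](big_setD1 i) //= mulrACA [_ * l i]mulrC.
have c0 (X : {set 'I_n}) : \prod_(k in X) l k != 0 by apply: sprod_neq0.
split=> T X cX; apply/vanishingE.
  have cX' : #|s @: X| = d.+1 by rewrite card_imset //; apply: perm_inj.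
  have /vanishingE H0 := T _ cX'; have H := (vanishing_perm _ s).2 H0.
  by apply: (vanishing_scaleI hS (c0 X)); apply: eq_vanishing H => i; rewrite E.
rewrite -(imset_preimE s X) in cX *.
apply: (vanishing_perm _ s).1.
have /vanishingE H : hyperplane (plucker_form v (s @^-1: X)) p.
  by apply: T; rewrite -cX card_imset //; apply: perm_inj.
by apply: eq_vanishing (vanishing_scale _ H) => i; rewrite E.
Qed.

Lemma act_tls d A s l v : monomial_with A s l ->
  act_set A (tls d v) = tls d (twist s l v).
Proof.
move=> mA; apply/seteqP; split=> [_ [p Tp <-]|q Tq]; first exact/tls_twist.
have [p Eq] := monomial_surj q mA; exists p => //.
by rewrite Eq in Tq; apply/tls_twist/Tq.
Qed.

Lemma invariant_tlsP d A s l v : monomial_with A s l -> is_plucker d v ->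
  act_set A (tls d v) = tls d v <-> proportional v (twist s l v).
Proof.
move=> mA pv; rewrite (act_tls _ _ mA); split=> [E|/(tls_proportional hS)->//].
by apply: (tls_inj hS pv) => //; apply: twist_plucker => //; case: mA.
Qed.

Lemma proportional_wedge v v' w w' :
  proportional v v' -> proportional w w' -> proportional (wedge v w) (wedge v'
    w').
Proof.
case=> a [b [a0 b0 vE]] [c [e [c0 e0 wE]]]; exists (a * c), (b * e).
split; [exact: muls_neq0|exact: muls_neq0|move=> I].
rewrite !wedgeE !mulr_sumr; apply: eq_bigr => K _.
by rewrite mulrACA vE wE mulrACA.
Qed.

Lemma twist_wedge s l v w :
  twist s l (wedge v w) = wedge (twist s l v) (twist s l w).
Proof.
apply/ffunP => X; rewrite ffunE !wedgeE mulr_sumr.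
rewrite [RHS](reindex_inj (imset_inj (@perm_inj _ s))) /=; apply: eq_big => K.
  by rewrite sub_imset_pre.
move=> KX; rewrite !ffunE preim_permE.
have -> : s @^-1: (X :\: s @: K) = (s @^-1: X) :\: K.
  by apply/setP => i; rewrite !inE (finset.mem_imset _ _ perm_inj).
rewrite mulrACA (big_setID K) /= (finset.setIidPr KX).
by congr (_ * _); rewrite mulrC.
Qed.

(** The weight of a complement is the total weight divided by that of the set, so the star inverts
    the weights, up to the scalar [\prod_i l i]. *)
Lemma star_twist s l v : (forall i, l i != 0) ->
  star (twist s l v) =
  ext_scale (\prod_i l i) (twist s (fun i => sinv (l i)) (star v)).
Proof.
move=> l0; apply/ffunP => X; rewrite !ffunE.
have -> : s @^-1: (~: X) = ~: s @^-1: X by apply/setP => i; rewrite !inE.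
rewrite mulrA; congr (_ * _); rewrite [in RHS](bigID (mem (s @^-1: X))) /=.
rewrite mulrAC -big_split /= [X in X * _]big1 ?mul1r.
  by apply: eq_bigl => i; rewrite !inE.
by move=> i _; rewrite mulVs.
Qed.

Lemma proportional_star s l v : (forall i, l i != 0) ->
  proportional v (twist s l v) ->
  proportional (star v) (twist s (fun i => sinv (l i)) (star v)).
Proof.
move=> l0 [a [b [a0 b0 E]]]; exists a, (b * \prod_i l i).
split=> // [|I]; first by apply: muls_neq0 => //; apply: sprod_neq0.
have := congr1 (fun u : ext S n => u I) (star_twist s v l0).
by rewrite !ffunE -mulrA => <-; rewrite E ffunE.
Qed.

End Monomial.

(** * Tropicalization of linear spaces *)

Section Valuation.
Variables (S : comNzSemiRingType) (hS : idempotent_semifield S).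
Variables (k : fieldType) (nu : k -> S) (nu_val : is_valuation nu).

Lemma nu0 : nu 0 = 0. Proof. by case: nu_val. Qed.
Lemma nu1 : nu 1 = 1. Proof. by case: nu_val. Qed.
Lemma nuM a b : nu (a * b) = nu a * nu b. Proof. by case: nu_val. Qed.

Lemma nuN a : nu (- a) = nu a.
Proof. by rewrite -mulN1r nuM; case: nu_val => _ _ -> _ _; rewrite mul1r. Qed.

Lemma nu_signM b a : nu ((-1) ^+ b * a) = nu a.
Proof.
elim: b => [|b IHb]; first by rewrite expr0 mul1r.
by rewrite exprS -mulrA mulN1r nuN.
Qed.

Lemma nu_neq0 a : a != 0 -> nu a != 0.
Proof.
move=> a0; have := oner_neq0 S; rewrite -nu1 -(mulfV a0) nuM.
by apply: contra_neq => ->; rewrite mul0r.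
Qed.

Lemma nu_sum (I : finType) (P : pred I) (F : I -> k) :
  nu (\sum_(i | P i) F i) <<= \sum_(i | P i) nu (F i).
Proof.
elim/big_rec2: _ => [|i y x _ IH]; first by rewrite nu0; apply: sle_refl.
apply: (@sle_trans _ (nu (F i) + nu x)).
  by case: nu_val => _ _ _ _ nuD; rewrite /sle addrA.
by apply: sleD2 => //; apply: sle_refl.
Qed.

(** Each term is minus the sum of the others, and nu ignores the sign. *)
Lemma nu_vanishing (I : finType) (x : I -> k) :
  \sum_i x i = 0 -> vanishing (fun i => nu (x i)).
Proof.
move=> sx j; move: sx; rewrite (bigD1 j) //= => /eqP;
  rewrite addr_eq0 => /eqP ->.
by rewrite nuN; apply: nu_sum.
Qed.

(** * Valuations of the maximal minors of a matrix *)

Section Grassmann.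
Variables (n d : nat) (N : 'M[k]_(d, n)).
Implicit Types (A B I X : {set 'I_n}).

Definition minor (f : 'I_d -> 'I_n) : k := \det (colsub f N).

(** Different enumerations of X give minors equal up to sign, hence one valuation, and an idempotent
    sum of equal terms is that value. This avoids ordering X. *)
Definition plucker_coord : ext S n :=
  [ffun X : {set 'I_n} =>
     \sum_(f : {ffun 'I_d -> 'I_n} | injectiveb f && (f @: [set: 'I_d] ==
       X)%SET)
       nu (minor f)].

Lemma minor_noninj (f : 'I_d -> 'I_n) q r : q != r -> f q = f r -> minor f = 0.
Proof.
move=> qr E; rewrite /minor -det_tr; apply: (determinant_alternate qr) => i.
by rewrite !mxE E.
Qed.

Lemma nu_minor_eq (f g : 'I_d -> 'I_n) : injective f -> injective g ->
  f @: [set: 'I_d]%SET = g @: [set: 'I_d]%SET -> nu (minor f) = nu (minor g).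
Proof.
move=> fI gI fg; have ex r : exists q, f r == g q.
  have : f r \in g @: [set: 'I_d]%SET by rewrite -fg imset_f ?inE.
  by case/imsetP => q _ ->; exists q.
pose h r := xchoose (ex r);
  have hE r : f r = g (h r) by apply/eqP/(xchooseP (ex r)).
have h_inj : injective h by move=> q r E; apply: fI; rewrite !hE E.
have -> : minor f = (-1) ^+ odd_perm (perm h_inj) * minor g.
  have -> : minor f = \det (row_perm (perm h_inj) (colsub g N)^T).
    by rewrite /minor -det_tr; congr (\det _); apply/matrixP => i j;
      rewrite !mxE permE hE.
  by rewrite row_permE det_mulmx det_perm det_tr.
exact: nu_signM.
Qed.

Lemma plucker_coordE (f : 'I_d -> 'I_n) X : injective f ->
  f @: [set: 'I_d]%SET = X -> plucker_coord X = nu (minor f).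
Proof.
move=> fI <-; rewrite ffunE; pose f' := [ffun r => f r].
have fE : f' =1 f by move=> r; rewrite ffunE.
apply: (sum_const hS (i := f')) => [|g].
  rewrite (eq_imset _ fE) eqxx andbT; apply/injectiveP.
  exact: (eq_inj fI (fun x => esym (fE x))).
by case/andP=> /injectiveP gI /eqP; apply: nu_minor_eq.
Qed.

Lemma plucker_coord_homog : homog d plucker_coord.
Proof.
move=> X cX; rewrite ffunE big_pred0 // => f; apply/negbTE.
apply: contra cX => /andP[/injectiveP fI /eqP <-].
by rewrite card_imset // cardsT card_ord.
Qed.

Lemma plucker_coord_neq0 : row_free N -> plucker_coord != 0.
Proof.
move=> Nfree; have Nfull : row_full N^T by rewrite /row_full mxrank_tr.
pose f := fullrankfun Nfull.
have fI : injective f by apply: fullrankfun_inj.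
have := fullrowsub_unit Nfull; rewrite -/f => U.
have m0 : minor f != 0.
  rewrite /minor -det_tr -unitfE -unitmxE; congr (_ \in unitmx): U.
  by apply/matrixP => i j; rewrite !mxE.
have := nu_neq0 m0; rewrite -(plucker_coordE fI erefl).
by apply: contra_neq => ->; rewrite ffunE.
Qed.

Lemma set_enum m X : #|X| = m ->
  exists2 f : 'I_m -> 'I_n, injective f & f @: [set: 'I_m]%SET = X.
Proof.
move=> cX; exists (fun r => enum_val (cast_ord (esym cX) r)).
  by move=> q r /enum_val_inj/cast_ord_inj.
apply/setP => x; apply/imsetP/idP => [[r _ ->]|xX]; first exact: enum_valP.
exists (cast_ord cX (enum_rank_in xX x)); first by rewrite inE.
by rewrite cast_ordK enum_rankK_in.
Qed.

(** Expansion along the first row of a determinant whose first row [u *m N] is a combination of the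
    others. *)
Lemma sum_minor (u : 'rV[k]_d) (f : 'I_d.+1 -> 'I_n) :
  \sum_r (u *m N) 0 (f r) * ((-1) ^+ r * minor (f \o lift r)) = 0.
Proof.
pose M : 'M[k]_d.+1 := \matrix_(i, j)
  if unlift ord0 i is Some r then N r (f j) else (u *m N) 0 (f j).
have M0 : \det M = 0.
  apply/eqP/det0P;
    exists (\row_i if unlift ord0 i is Some r then - u 0 r else 1).
    apply/eqP => /rowP/(_ ord0); rewrite !mxE unlift_none => /eqP.
    by rewrite oner_eq0.
  apply/rowP => j; rewrite [in RHS]mxE mxE big_ord_recl !mxE unlift_none mul1r.
  rewrite -big_split big1 //= => r _.
  by rewrite !mxE liftK mulNr addrN.
rewrite -[RHS]M0 (expand_det_row M ord0); apply: eq_bigr => r _.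
rewrite [M ord0 r]mxE unlift_none /cofactor add0n; congr (_ * (_ * \det _)).
by apply/matrixP => i j; rewrite !mxE liftK.
Qed.

(** With f enumerating A, the terms of the tropical form of A are the valuations of the terms of
    [sum_minor]. *)
Lemma row_space_tls (u : 'rV[k]_d) : tls d plucker_coord (map_mx nu (u *m N)^T).
Proof.
move=> A /set_enum[f fI fA]; apply/vanishingE => j; rewrite mxE.
case: ifP => [|_]; last by rewrite mul0r; apply: sle0.
have coordE r : plucker_coord (A :\ f r) = nu (minor (f \o lift r)).
  apply: plucker_coordE; first exact: inj_comp fI (@lift_inj _ r).
  apply/setP => x; rewrite -fA !inE; apply/imsetP/andP.
    case=> q _ -> /=; rewrite imset_f ?inE // (inj_eq fI); split=> //.
    by rewrite eq_sym neq_lift.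
  case=> xr /imsetP[q _ Ex]; rewrite Ex (inj_eq fI) eq_sym in xr *.
  by have [q' -> _] := unlift_some xr; exists q'.
rewrite -fA => /imsetP[r _ ->{j}].
have term q : plucker_coord (A :\ f q) * map_mx nu (u *m N)^T (f q) 0 =
    nu ((u *m N) 0 (f q) * ((-1) ^+ q * minor (f \o lift q))).
  by rewrite coordE nuM nu_signM mulrC !mxE.
rewrite fA term; apply: sle_trans (nu_vanishing (sum_minor u f) r) _.
apply: sle_sum2 => // q qr; exists (f q); first by rewrite (inj_eq fI).
by rewrite -term [plucker_form _ _ _ _]mxE -fA imset_f ?inE //; apply: sle_refl.
Qed.

End Grassmann.

(** The minor on the columns i and B is linear in column i; its coefficients, the signed minors on B
    with one row removed, form u. *)
Lemma cocircuit_row_space n d (N : 'M[k]_(d, n)) (B : {set 'I_n}) :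
  #|B|.+1 = d ->
  exists u : 'rV_d, cocircuit (plucker_coord N) B = map_mx nu (u *m N)^T.
Proof.
case: d N => // d N [/set_enum[f fI fB]].
pose g i (r : 'I_d.+1) := if unlift ord0 r is Some q then f q else i.
have g0 i : g i ord0 = i by rewrite /g unlift_none.
have gS i q : g i (lift ord0 q) = f q by rewrite /g liftK.
exists (\row_r ((-1) ^+ r * \det (row' r (colsub f N)))).
apply/matrixP => i j; rewrite !mxE.
transitivity (nu (minor N (g i))).
  (* For i in B the minor has a repeated column, and the coordinate at [i |: B = B] is 0 for reasons
     of degree. *)
  have [iB|iB] := boolP (i \in B).
    have : i \in f @: [set: 'I_d]%SET by rewrite fB.
    case/imsetP=> q _ iE;
      rewrite (@minor_noninj _ _ N _ ord0 (lift ord0 q)) ?nu0 //.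
      rewrite setU1_mem // (@plucker_coord_homog _ _ N) // -fB card_imset //.
      by rewrite cardsT card_ord neq_ltn ltnSn.
    by rewrite g0 gS.
  apply: plucker_coordE.
    have fi q : f q != i.
      by apply: contraNneq iB => <-; rewrite -fB imset_f ?inE.
    move=> q r; rewrite /g; case: unliftP => [q'|] ->;
      case: unliftP => [r'|] -> //.
    - by move/fI->.
    - by move/eqP; rewrite (negbTE (fi _)).
    - by move/esym/eqP; rewrite (negbTE (fi _)).
  apply/setP => x; rewrite !inE -fB; apply/imsetP/orP.
    case=> q _ ->; rewrite /g; case: unliftP => [q'|] _; last by left.
    by right; rewrite imset_f ?inE.
  case=> [/eqP->|/imsetP[q _ ->]]; first by exists ord0; rewrite ?inE ?g0.
  by exists (lift ord0 q); rewrite ?inE ?gS.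
congr nu; rewrite /minor (expand_det_col _ ord0); apply: eq_bigr => r _.
rewrite !mxE g0 mulrC /cofactor addn0; congr (_ * \det _ * _).
by apply/matrixP => a b; rewrite !mxE gS.
Qed.

Section Tropicalization.
Variable n : nat.
Implicit Types (L : {vspace 'cV[k]_n}) (M : 'M[k]_n).

Lemma trop_submodule L : is_submodule (trop nu L).
Proof.
split=> [U [[U0 _ _] _]|p q Tp Tq U HU|c p Tp U HU] //.
  by have [[_ UD _] _] := HU; apply: UD; [apply: Tp|apply: Tq].
by have [[_ _ UZ] _] := HU; apply: UZ; apply: Tp.
Qed.

Lemma trop_gen L w : w \in L -> trop nu L (map_mx nu w).
Proof. by move=> Lw U [_]; apply; exists w. Qed.

Lemma trop_min L (U : set 'cV[S]_n) : is_submodule U ->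
  (forall w, w \in L -> U (map_mx nu w)) -> (trop nu L `<=` U)%classic.
Proof. by move=> subU LU p; apply; split=> // _ [w Lw <-]; apply: LU. Qed.

Lemma trop_tls L : exists2 v, is_plucker (\dim L) v & trop nu L = tls (\dim L)
  v.
Proof.
pose N : 'M[k]_(\dim L, n) := \matrix_(r, i) ((vbasis L)`_r) i 0.
have rowE u : (u *m N)^T = \sum_r u 0 r *: (vbasis L)`_r.
  apply/matrixP => i j; rewrite ord1 !mxE summxE; apply: eq_bigr => r _.
  by rewrite !mxE.
have inL u : (u *m N)^T \in L.
  rewrite rowE memv_suml // => r _; rewrite memvZ // vbasis_mem // mem_nth //.
  by rewrite size_tuple.
have ofL w : w \in L -> exists u, w = (u *m N)^T.
  move=> /coord_vbasis wE; exists (\row_r coord (vbasis L) r w).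
  by rewrite rowE {1}wE; apply: eq_bigr => r _; rewrite mxE.
have Nfree : row_free N.
  rewrite -kermx_eq0; apply/eqP/row_matrixP => r; rewrite row0.
  have uN : row r (kermx N) *m N = 0 by apply/sub_kermxP/row_sub.
  have := rowE (row r (kermx N)); rewrite uN trmx0 => /esym.
  have /freeP free_basis := basis_free (vbasisP L).
  by move=> /free_basis u0; apply/rowP => i; rewrite u0 mxE.
pose v := plucker_coord N.
have v0 : v != 0 by apply: plucker_coord_neq0.
have hv : homog (\dim L) v by apply: plucker_coord_homog.
have coc (B : {set 'I_n}) : #|B|.+1 =
  \dim L -> exists2 w, w \in L & cocircuit v B = map_mx nu w.
  by case/(cocircuit_row_space N) => u uE; exists (u *m N)^T.
(* The exchange relation for A, B is the relation of A at [cocircuit v B], the valuation of a vector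
   of L, so [row_space_tls] provides it. *)
have pv : is_plucker (\dim L) v.
  apply/is_pluckerE; split=> // A B j jA jB.
  have [->|/(homog_card hv)] := eqVneq (v (j |: B)) 0; first by rewrite mulr0;
    apply: sle0.
  rewrite cardsU1 jB => cB; have [w /ofL[u ->] cE] := coc _ cB.
  have := (tlsP hS _ hv).1 (row_space_tls N u) A j jA; rewrite -cE mxE => le.
  apply: sle_trans le _; apply: sle_sum => i /andP[iA ij]; rewrite mxE.
  have [iB|iB] := boolP (i \in B).
    rewrite setU1_mem // (hv B) ?mulr0; first exact: sle0.
    by rewrite -cB neq_ltn ltnSn.
  by apply: (sle_bigl hS (i := i)); rewrite ?iA ?iB //; apply: sle_refl.
exists v => //; apply/seteqP; split=> [|p Tp].
  by apply: trop_min => [|w /ofL[u ->]];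
    [exact: tls_submodule|exact: row_space_tls].
apply: (tls_span hS v0 hv Tp (trop_submodule L)) => B /coc[w Lw ->].
exact: trop_gen.
Qed.

Lemma is_monomialE M : is_monomial M -> exists s c, monomial_with M s c.
Proof.
case=> rows cols; have ex j : exists i, M i j != 0 by have [i []] := cols j;
  exists i.
pose f j := xchoose (ex j); have fP j : M (f j) j != 0 := xchooseP (ex j).
have M0 i j : i != f j -> M i j = 0.
  move=> nij; apply: contraNeq nij => Mij; have [i' [_ u]] := cols j.
  by rewrite -(u i Mij) (u _ (fP j)).
have f_inj : injective f.
  move=> i j E; have [i' [_ u]] := rows (f i).
  by rewrite -(u i (fP i)) -(u j) // E.
exists (perm f_inj), (fun j => M (f j) j); split=> // i j; rewrite permE.
by have [->|/M0->] := eqVneq j (f i); rewrite ?mulr1 ?mulr0.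
Qed.

Lemma map_monomial M s c : monomial_with M s c ->
  monomial_with (map_mx nu M) s (fun i => nu (c i)).
Proof.
case=> c0 ME; split=> [i|i j]; first exact: nu_neq0.
by rewrite mxE ME nuM; case: eqP => _; rewrite ?nu0 ?nu1.
Qed.

(** Although nu is not additive, every entry of [M *m X] is a single product, so multiplicativity
    suffices. *)
Lemma map_monomial_mul q M s c (X : 'M[k]_(n, q)) : monomial_with M s c ->
  map_mx nu (M *m X) = map_mx nu M *m map_mx nu X.
Proof.
move=> mM; apply/matrixP => i j; rewrite -(permKV s i).
rewrite (monomial_mulmx _ _ _ (map_monomial mM)) mxE (monomial_mulmx _ _ _ mM).
by rewrite nuM mxE.
Qed.

(** Minimality of the tropicalization is used twice: against the image of [trop nu L], and against
    the preimage of the tropicalization of the moved space. *)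
Lemma trop_act M s c L : monomial_with M s c ->
  trop nu (act_vspace M L) = act_set (map_mx nu M) (trop nu L).
Proof.
move=> mM; have [T0 TD TZ] := trop_submodule L.
apply/seteqP; split=> [|_ [p Tp <-]].
  apply: trop_min => [|w /memv_imgP[u Lu ->]]; last first.
    by rewrite lfunE /= (map_monomial_mul _ mM); exists (map_mx nu u) => //;
      apply: trop_gen.
  split=> [|_ _ [p Tp <-] [q Tq <-]|a _ [p Tp <-]].
  - by exists 0; rewrite ?mulmx0.
  - by exists (p + q); rewrite ?mulmxDr //; apply: TD.
  - by exists (a *: p); rewrite ?scalemxAr //; apply: TZ.
have [U0 UD UZ] := trop_submodule (act_vspace M L).
apply: (trop_min (U := [set x | trop nu (act_vspace M L) (map_mx nu M *m
  x)]%classic) _ _ Tp).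
  split=> [|x y Ux Uy|a x Ux] /=; first by rewrite mulmx0.
    by rewrite mulmxDr; apply: UD.
  by rewrite -scalemxAr; apply: UZ.
move=> w Lw /=; rewrite -(map_monomial_mul _ mM); apply: trop_gen.
by apply/memv_imgP; exists w; rewrite // lfunE.
Qed.

End Tropicalization.

End Valuation.

(** * Representations *)

Section WedgePlucker.
Variables (S : comNzSemiRingType) (hS : idempotent_semifield S) (n : nat).
Implicit Types v w : ext S n.

Lemma wedge_homog d d' v w : homog d v -> homog d' w -> homog (d + d') (wedge v
  w).
Proof.
move=> hv hw X cX; rewrite wedgeE big1 // => K KX.
have [->|/(homog_card hv) cv] := eqVneq (v (X :\: K)) 0; first by rewrite mul0r.
have [->|/(homog_card hw) cw] := eqVneq (w K) 0; first by rewrite mulr0.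
by case/eqP: cX; rewrite -cv -cw -(cardsID K X) (finset.setIidPr KX) addnC.
Qed.

Lemma wedge_plucker d d' v w : is_plucker d v -> is_plucker d' w ->
  wedge v w != 0 -> is_plucker (d + d') (wedge v w).
Proof.
move=> /is_pluckerE[_ hv xv] /is_pluckerE[_ hw xw] vw0; apply/is_pluckerE.
by split=> //; [apply: wedge_homog|apply: wedge_exchange].
Qed.

Lemma stable_intersection_plucker d d' v w : is_plucker d v -> is_plucker d' w
  ->
  wedge (star v) (star w) != 0 ->
  is_plucker (d + d' - n) (star (wedge (star v) (star w))).
Proof.
move=> pv pw vw0; have [v0 hv _] := pv; have [w0 hw _] := pw.
have := star_plucker hS (wedge_plucker (star_plucker hS pv) (star_plucker hS
  pw) vw0).
(* As d and d' are at most n, the degree [n - ((n - d) + (n - d'))] is [d + d' - n]. *)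
by rewrite subnDA (subKn (homog_le v0 hv)) (subnBA _ (homog_le w0 hw)).
Qed.

Lemma pclassP v w : pclass v = pclass w <-> proportional v w.
Proof.
split=> [E|[a [b [a0 b0 E]]]].
  have : pclass w w.
    by exists 1; rewrite ?oner_neq0 //; apply/ffunP => I; rewrite ffunE mul1r.
  rewrite -E => -[a a0 ->]; exists a, 1; split=> //; first exact: oner_neq0.
  by move=> I; rewrite ffunE mul1r.
apply/seteqP; split=> _ [c c0 ->].
  exists (c * b * sinv a); first by rewrite !muls_neq0 ?sinv_neq0.
  apply/ffunP => I; rewrite !ffunE; apply: (mulsI hS a0).
  by rewrite mulrCA E [RHS]mulrA [a * _]mulrC -[_ * sinv a * a]mulrA [sinv a *
    a]mulrC
    mulVs // mulr1 mulrA.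
exists (c * a * sinv b); first by rewrite !muls_neq0 ?sinv_neq0.
apply/ffunP => I; rewrite !ffunE; apply: (mulsI hS b0).
by rewrite mulrCA -E [RHS]mulrA [b * _]mulrC -[_ * sinv b * b]mulrA [sinv b *
  b]mulrC
  mulVs // mulr1 mulrA.
Qed.

End WedgePlucker.

Section Representation.
Variables (S : comNzSemiRingType) (hS : idempotent_semifield S) (n : nat).
Variables (G : groupType) (rho : G -> 'M[S]_n) (rho_rep : is_linear_rep rho).
Implicit Types (v w : ext S n) (g h : G).

Lemma rep_invK g : rho g *m rho g^-1%g = 1%:M.
Proof. by case: rho_rep => r1 rM; rewrite -rM mulgV. Qed.

Lemma rep_monomial g : exists s l, monomial_with (rho g) s l.
Proof. exact: invertible_monomial (rep_invK g). Qed.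

Lemma ext_act1 v : ext_act rho 1%g v = v.
Proof.
case: rho_rep => r1 _; rewrite /ext_act r1.
by rewrite (ext_map_twist _ (monomial1 _ _)) twist1.
Qed.

Lemma ext_actM g h v : ext_act rho (g * h)%g v = ext_act rho g (ext_act rho h
  v).
Proof.
have [[s [l mg]] [t [m mh]]] := (rep_monomial g, rep_monomial h).
case: rho_rep => _ rM;
  rewrite /ext_act rM (ext_map_twist _ (monomialM hS mg mh)).
by rewrite (ext_map_twist _ mh) (ext_map_twist _ mg) twist_comp.
Qed.

Lemma class_act_pclass g v : class_act rho g (pclass v) = pclass (ext_act rho g
  v).
Proof.
have [s [l mg]] := rep_monomial g.
have scaleE a : ext_act rho g (ext_scale a v) = ext_scale a (ext_act rho g v).
  rewrite /ext_act !(ext_map_twist _ mg); apply/ffunP => X.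
  by rewrite !ffunE mulrCA.
apply/seteqP; split=> [_ [_ [a a0 ->] <-]|_ [a a0 ->]]; first by exists a.
by rewrite -scaleE; exists (ext_scale a v) => //; exists a.
Qed.

Lemma ext_act_plucker d g v : is_plucker d v -> is_plucker d (ext_act rho g v).
Proof.
have [s [l mg]] := rep_monomial g; rewrite /ext_act (ext_map_twist _ mg).
by apply: twist_plucker => //; case: mg.
Qed.

(** Either side says that v and its image under g are proportional, by [pclassP] for the class and
    by [invariant_tlsP] for the linear space. *)
Lemma class_fixedP d g v : is_plucker d v ->
  class_act rho g (pclass v) = pclass v <-> act_set (rho g) (tls d v) = tls d v.
Proof.
move=> pv; have [s [l mg]] := rep_monomial g.
rewrite (invariant_tlsP hS mg pv) class_act_pclass
  /ext_act (ext_map_twist _ mg).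
by split=> [/esym|] /(pclassP hS) => [//|->].
Qed.

Lemma homog_action d : is_action_on (@homog S n d) (ext_act rho).
Proof.
split=> [g v hv|v _|g h v _]; [|exact: ext_act1|exact: ext_actM].
have [s [l mg]] := rep_monomial g; rewrite /ext_act (ext_map_twist _ mg).
exact: twist_homog.
Qed.

Lemma dressian_action d : is_action_on (@dressian S n d) (class_act rho).
Proof.
split=> [g _ [v pv <-]|_ [v _ <-]|g h _ [v _ <-]]; rewrite !class_act_pclass.
- by exists (ext_act rho g v) => //; apply: ext_act_plucker.
- by rewrite ext_act1.
- by rewrite ext_actM.
Qed.

Lemma dressian_fixed_bij d :
  set_bij (dressian_fixed rho d) (tropical_rep_dim rho d) (tls_class d).
Proof.
split.
- move=> _ [[v pv <-] fix_v]; rewrite tls_class_pclass; split;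
    first by exists v.
  by move=> g; apply/class_fixedP.
- move=> c c'; rewrite !inE => -[[v pv <-] _] [[w pw <-] _].
  by rewrite !tls_class_pclass => /(tls_inj hS pv pw)/(pclassP hS).
- move=> _ [[v pv ->] inv]; exists (pclass v); last exact: tls_class_pclass.
  by split=> [|g]; [exists v|apply/(class_fixedP g pv)].
Qed.

Lemma invariant_twist d v g s l : is_plucker d v -> G_invariant rho (tls d v) ->
  monomial_with (rho g) s l -> proportional v (twist s l v).
Proof. by move=> pv inv mg; apply/(invariant_tlsP hS mg pv). Qed.

Lemma stable_sum_rep (T T' U : set 'cV[S]_n) :
  tropical_rep rho T -> tropical_rep rho T' -> is_stable_sum T T' U ->
  tropical_rep rho U.
Proof.
move=> [_ invT] [_ invT'] [d [d' [v [w [[pv TE] [pw T'E] vw0 ->]]]]].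
rewrite TE in invT; rewrite T'E in invT'.
have pvw := wedge_plucker hS pv pw vw0.
split=> [|g]; first by exists (d + d')%N, (wedge v w).
have [s [l mg]] := rep_monomial g; apply/(invariant_tlsP hS mg pvw).
rewrite twist_wedge; apply: proportional_wedge => //.
  exact: invariant_twist invT mg.
exact: invariant_twist invT' mg.
Qed.

Lemma stable_intersection_rep (T T' U : set 'cV[S]_n) :
  tropical_rep rho T -> tropical_rep rho T' -> is_stable_intersection T T' U ->
  tropical_rep rho U.
Proof.
move=> [_ invT] [_ invT'] [d [d' [v [w [[pv TE] [pw T'E] vw0 ->]]]]].
rewrite TE in invT; rewrite T'E in invT'.
have pvw := stable_intersection_plucker hS pv pw vw0.
split=> [|g].
  by exists (d + d' - n)%N, (star (wedge (star v) (star w))).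
have [s [l mg]] := rep_monomial g; apply/(invariant_tlsP hS mg pvw).
have [l0 _] := mg; have l'0 i : sinv (l i) != 0 by apply: sinv_neq0.
(* The star is taken before and after the wedge, so the weights get inverted twice. *)
have -> : l = (fun i => sinv (sinv (l i))) by apply/funext => i; rewrite sinvK.
apply: proportional_star => //; rewrite twist_wedge;
  apply: proportional_wedge => //.
  by apply: proportional_star => //; apply: invariant_twist invT mg.
by apply: proportional_star => //; apply: invariant_twist invT' mg.
Qed.

(** The inverse transpose keeps the permutation and inverts the weights, which are then those
    produced by [star_twist]. Each entry is read off [rho g^-1 *m rho g = 1]. *)
Lemma dual_monomial g s l : monomial_with (rho g) s l ->
  monomial_with (dual_rep rho g) s (fun i => sinv (l i)).
Proof.
move=> mg; have [l0 rhoE] := mg; split=> [i|i j]; first exact: sinv_neq0.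
case: rho_rep => r1 rM; have := rM g^-1%g g; rewrite mulVg r1.
move=> /(congr1 (fun M : 'M_n => M i (s^-1%g j))); rewrite !mxE.
rewrite (bigD1 j) //= big1 ?addr0 => [|k /negbTE kj]; last first.
  by rewrite rhoE permKV kj !mulr0.
rewrite rhoE permKV eqxx mulr1 -(can2_eq (permK s) (permKV s)) eq_sym => E.
apply: (mulsI hS (l0 (s^-1%g j))); rewrite mulrC -E mulrA.
by case: eqP => [->|_]; rewrite ?mulr0 // mulr1 permK mulVs.
Qed.

Lemma orthogonal_dual_rep (T : set 'cV[S]_n) :
  tropical_rep rho T -> tropical_rep (dual_rep rho) (orthogonal_dual T).
Proof.
move=> [[d [v [pv TE]]] inv]; rewrite {}TE in inv *.
rewrite (orthogonal_dual_tls hS pv); have pv' := star_plucker hS pv.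
split=> [|g]; first by exists (n - d)%N, (star v).
have [s [l mg]] := rep_monomial g; have [l0 _] := mg.
apply/(invariant_tlsP hS (dual_monomial mg) pv').
by apply: proportional_star => //; apply: invariant_twist inv mg.
Qed.

End Representation.

(** * The Boolean case: matroid automorphisms *)

Section BooleanRepresentation.
Variables (n d : nat) (v : ext boolean_semifield n) (v_plucker : is_plucker d
  v).
Implicit Types s : 'S_n.
Let hB := boolean_idempotent_semifield.

Lemma boolean_neq0 (a : boolean_semifield) : a != 0 -> a = 1.
Proof. by case: a. Qed.

Lemma perm_gl_monomial s : monomial_with (perm_gl s) s (fun=> 1).
Proof. by split=> [i|i j]; rewrite ?oner_neq0 // mxE mul1r. Qed.

Lemma monomial_perm_gl (A : 'M[boolean_semifield]_n) s l :
  monomial_with A s l -> A = perm_gl s.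
Proof.
by case=> l0 AE; apply/matrixP => i j;
  rewrite AE mxE (boolean_neq0 (l0 j)) mul1r.
Qed.

(** An automorphism sends a basis to an independent set of size d, hence to a basis. Being injective
    on the finite set of bases it is onto, so the support of v is preserved in both directions, and
    v takes only the values 0 and 1. *)
Lemma matroid_autP s :
  s \in matroid_aut (plucker_matroid v_plucker) <-> twist s (fun=> 1) v = v.
Proof.
have [_ hv _] := v_plucker;
  have one1 X : \prod_(i in X) 1 = 1 :> boolean_semifield.
  exact: big1.
split=> [|E]; rewrite inE.
  move=> /forallP aut; have closed I : v I != 0 -> v (s @: I) != 0.
    move=> vI; have indepI : indep (plucker_matroid v_plucker) I.
      by apply/existsP; exists I; rewrite fintype.subxx inE (boolean_neq0 vI).
    have /existsP[J] := implyP (aut I) indepI;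
      rewrite inE => /andP[/eqP vJ sIJ].
    have vJ0 : v J != 0 by rewrite vJ oner_neq0.
    suff -> : s @: I = J by [].
    apply/eqP; rewrite eqEcard sIJ card_imset; last exact: perm_inj.
    by rewrite (homog_card hv vI) (homog_card hv vJ0) leqnn.
  pose B := [set I : {set 'I_n} | v I != 0]%SET.
  have sB : [set s @: (I : {set 'I_n}) | I in B]%SET = B.
    apply/eqP; rewrite eqEcard; apply/andP; split.
      apply/fintype.subsetP => K /imsetP[I]; rewrite inE => vI EK.
      by rewrite EK inE closed.
    by rewrite card_imset //; apply/imset_inj/perm_inj.
  apply/ffunP => X; rewrite ffunE one1 mul1r.
  have EX : (v (s @^-1: X) != 0) = (v X != 0).
    have <- : (X \in B) = (v X != 0) by rewrite inE.
    rewrite -sB -{2}(imset_preimE s X) (finset.mem_imset _ _ (imset_inj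
      (@perm_inj _ s))).
    by rewrite inE.
  by move: EX; case: (v X); case: (v _).
apply/forallP => J; apply/implyP => /existsP[I];
  rewrite inE => /andP[/eqP vI JI].
apply/existsP; exists (s @: I); rewrite imsetS // andbT inE -E ffunE one1 mul1r.
by rewrite preim_permE vI.
Qed.

(** The only nonzero scalar is 1, so invertible matrices are permutation matrices and proportional
    vectors are equal. *)
Lemma boolean_invariantP (G : groupType) (rho : G -> 'M[boolean_semifield]_n) :
  is_linear_rep rho ->
  G_invariant rho (tls d v) <->
  forall g, exists2 s, s \in matroid_aut (plucker_matroid v_plucker) & rho g =
    perm_gl s.
Proof.
move=> rep; split=> [inv|aut] g.
  have [s [l mg]] := rep_monomial hB rep g; have rhoE := monomial_perm_gl mg.
  exists s => //; apply/matroid_autP.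
  rewrite rhoE in mg; have m1 := perm_gl_monomial s; rewrite -rhoE in m1.
  have [a [b [/boolean_neq0->
    /boolean_neq0-> E]]] := invariant_twist hB v_plucker inv m1.
  by apply/ffunP => X; have := E X; rewrite !mul1r.
have [s /matroid_autP sE rhoE] := aut g.
have m1 := perm_gl_monomial s; rewrite -rhoE in m1.
apply/(invariant_tlsP hB m1 v_plucker); rewrite sE.
by exists 1, 1; split; rewrite ?oner_neq0.
Qed.

End BooleanRepresentation.

Theorem theorem1 (G : groupType) (S : comNzSemiRingType)
    (hS : idempotent_semifield S) (n : nat) (rho : G -> 'M[S]_n)
    (hrho : is_linear_rep rho) :
  (* (1) *)
  (forall d : nat, (1 <= d <= n)%N ->
     [/\ is_action_on (@homog S n d) (ext_act rho),
         is_action_on (@dressian S n d) (class_act rho) &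
         set_bij (dressian_fixed rho d) (tropical_rep_dim rho d)
                 (tls_class d)]) /\
  (* (2) *)
  (forall (rhoB : G -> 'M[boolean_semifield]_n), is_linear_rep rhoB ->
   forall (d : nat) (v : ext boolean_semifield n) (hv : is_plucker d v),
     G_invariant rhoB (tls d v) <->
     (forall g : G, exists2 s : 'S_n,
        s \in matroid_aut (plucker_matroid hv) & rhoB g = perm_gl s)) /\
  (* (3) *)
  ((forall T T' U : set 'cV[S]_n, tropical_rep rho T -> tropical_rep rho T' ->
      is_stable_sum T T' U \/ is_stable_intersection T T' U ->
      tropical_rep rho U) /\
   (totally_ordered S ->
    forall T : set 'cV[S]_n, tropical_rep rho T ->
      tropical_rep (dual_rep rho) (orthogonal_dual T))) /\
  (* (4) *)
  (forall (k : fieldType) (nu : k -> S) (rhoW : G -> 'M[k]_n),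
     is_valuation nu -> is_linear_rep rhoW ->
     (forall g : G, is_monomial (rhoW g)) ->
     let rho_nu := fun g : G => map_mx nu (rhoW g) in
     [/\ is_linear_rep rho_nu,
         (forall L : {vspace 'cV[k]_n},
            (forall g : G, act_vspace (rhoW g) L = L) ->
            tropical_rep rho_nu (trop nu L)) &
         (forall (L : {vspace 'cV[k]_n}) (g : G),
            trop nu (act_vspace (rhoW g) L) =
            act_set (rho_nu g) (trop nu L))]).

Proof.
split; last split; last split; last first.
- move=> k nu rhoW nu_val [r1 rM] mon rho_nu.
  have mW g := is_monomialE (mon g).
  have rep_nu : is_linear_rep rho_nu.
    split=> [|g h]; rewrite /rho_nu.
      apply/matrixP => i j; rewrite r1 !mxE.
      by case: eqP => _; rewrite ?(nu0 nu_val) ?(nu1 nu_val).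
    by have [s [c mg]] := mW g; rewrite rM (map_monomial_mul nu_val _ mg).
  have equiv L g : trop nu (act_vspace (rhoW g) L) =
    act_set (rho_nu g) (trop nu L).
    by have [s [c mg]] := mW g; apply: trop_act mg.
  split=> // L invL; split=> [|g]; last by rewrite -equiv invL.
  by have [v pv ->] := trop_tls hS nu_val L; exists (\dim L), v.
- split=> [T T' U repT repT' []|_ T repT].
  + exact: stable_sum_rep.
  + exact: stable_intersection_rep.
  + exact: orthogonal_dual_rep.
- by move=> rhoB repB d v hv; apply: boolean_invariantP.
- move=> d _; split; [exact: homog_action|exact: dressian_action|].
  exact: dressian_fixed_bij.
Qed.
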